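(* Let $m,\ell\in\mathbb N$ and let $p,q$ be real numbers with $q\ge p>1$ and $\varrho := q(\ell-m/p)>0$. Let $\nu$ be a finite non-zero Borel measure on the half-open unit cube $\mathbf Q=(0,1]^m$. Then $$\overline{\mathbf{ord}}\left(\mathscr S W_p^\ell(\mathbf Q),L^q_\nu(\mathbf Q)\right)\le -\frac{1}{q\cdot s_\varrho}.$$
   Context: Sobolev space: $W_p^\ell(\mathbf Q)=W_p^\ell(\mathring{\mathbf Q})$ is the set of real-valued $f\in L^p(\mathring{\mathbf Q})$ (Lebesgue measure $\Lambda$) whose weak derivatives up to order $\ell$ lie in $L^p$, with norm $\|f\|_{W_p^\ell}=\|f\|_{L^p}+\left(\int|\nabla_\ell f|^p\,d\Lambda\right)^{1/p}$, where $|\nabla_\ell f|=\left(\sum_{|k|=\ell}|D^kf|^2\right)^{1/2}$. Since $\ell p/m>1$, $W_p^\ell(\mathbf Q)$ embeds compactly into $\mathcal C(\overline{\mathbf Q})$; one always takes the continuous representative, and in this way regards elements of $W_p^\ell(\mathbf Q)$ as elements of $L^q_\nu=L^q_\nu(\mathbf Q)$. For a normed space $V$, $\mathscr S V=\{f\in V:\|f\|_V=1\}$. For $K\subset V$ and $n\in\mathbb N$, the Kolmogorov $n$-diameter is $d_n(K,V)=\inf_{V_n}\sup_{x\in K}\inf_{y\in V_n}\|x-y\|_V$, the outer infimum being over all linear subspaces $V_n\subset V$ of dimension at most $n$. The upper approximation order is $\overline{\mathbf{ord}}(K,V)=\limsup_{n\to\infty}\frac{\log d_n(K,V)}{\log n}$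 (with $\log 0=-\infty$). Here $K=\mathscr S W_p^\ell(\mathbf Q)$, viewed as a subset of $V=L^q_\nu(\mathbf Q)$. $L^q$-spectrum: for $n\in\mathbb N$ let $\mathcal D_n$ be the set of dyadic cubes $Q=\prod_{k=1}^m(l_k2^{-n},(l_k+1)2^{-n}]$, $l_k\in\mathbb Z$, with $\nu(Q)>0$. For $s\in\mathbb R$ put $\beta_n^\nu(s)=\log\left(\sum_{C\in\mathcal D_n}\nu(C)^s\right)/\log(2^n)$ and $\beta_\nu(s)=\limsup_{n\to\infty}\beta_n^\nu(s)$. For $b>0$, $s_b=\inf\{s>0:\beta_\nu(s)-bs\le 0\}$. Convention: $1/0=+\infty$, so the bound is $-\infty$ if $s_\varrho=0$. *)

(* Defs.v *)
From HB Require Import structures.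
From mathcomp Require Import all_boot all_order all_algebra.
From mathcomp Require Import all_classical all_reals all_analysis.
Set Implicit Arguments.
Unset Strict Implicit.
Unset Printing Implicit Defensive.
Import Order.TTheory GRing.Theory Num.Theory.
Import numFieldNormedType.Exports.
Local Open Scope classical_set_scope.
Local Open Scope ring_scope.

Section borel_matrix.
Context (R : realType) (m n : nat).
Let opens := @open 'M[R]_(m, n).

(* Borel sigma-algebra *)
HB.instance Definition _ :=
  @isMeasurable.Build (sigma_display opens) 'M[R]_(m, n) <<s opens >>
    (@sigma_algebra0 _ setT opens) (@sigma_algebraC _ opens)
    (@sigma_algebra_bigcup _ setT opens).

End borel_matrix.

Section lebesgue_measure_rV.
Context {R : realType}.

Let consrV n (xv : R * 'rV[R]_n) : 'rV[R]_n.+1 := row_mx xv.1%:M xv.2.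

Let measurable_openrV n (A : set 'rV[R]_n) : open A -> measurable A.
Proof. exact: sub_sigma_algebra. Qed.

Let consrV0 n xv : @consrV n xv ord0 ord0 = xv.1.
Proof.
rewrite /consrV (_ : ord0 = lshift n (ord0 : 'I_1)); last exact/val_inj.
by rewrite (@row_mxEl _ 1 1 n) mxE eqxx mulr1n.
Qed.

Let consrVS n xv j : @consrV n xv ord0 (lift ord0 j) = xv.2 ord0 j.
Proof.
rewrite /consrV (_ : lift ord0 j = rshift 1 j); last exact/val_inj.
by rewrite (@row_mxEr _ 1 1 n).
Qed.

Let consrV_ball n (a : 'rV[R]_n.+1) (r : R) : 0 < r ->
  @consrV n @^-1` ball a r =
  ball (a ord0 ord0) r `*` ball (\row_j a ord0 (lift ord0 j)) r.
Proof.
move=> r0; apply/seteqP; split => -[x v].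
- move=> [_ axv]; split; first by have := axv ord0 ord0; rewrite consrV0.
  split => // i j; rewrite mxE.
  by have := axv ord0 (lift ord0 j); rewrite consrVS [i]ord1.
- move=> [/= ax [_ av]]; split => // i j; rewrite [i]ord1 {i}.
  case: (unliftP ord0 j) => [k|] ->; last by rewrite consrV0.
  by have := av ord0 k; rewrite consrVS mxE.
Qed.

Let measurable_consrV n :
  measurable_fun [set: measurableTypeR R * 'rV[R]_n] (@consrV n).
Proof.
apply: (@measurability _ _ _ _ _ _ (@open 'rV[R]_n.+1)) => //.
move=> _ [U oU <-]; rewrite setTI.
pose c (i : 'rV[rat]_n.+1 * nat) : 'rV[R]_n.+1 := map_mx ratr i.1.
pose F i := [set xv : R * 'rV[R]_n |
  ball (c i) i.2.+1%:R^-1 `<=` U /\ (@consrV n @^-1` ball (c i) i.2.+1%:R^-1) xv].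
rewrite [X in measurable X](_ : _ = \bigcup_i F i); last first.
  apply/seteqP; split => [xv /= Uxv|xv [i _ [/= + ?]]]; last exact.
  have /nbhs_ballP[e /= e0 eU] : nbhs (consrV xv) U by apply: open_nbhs_nbhs.
  have [k ke] : exists k : nat, k.+1%:R^-1 < e / 2.
    have := near_infty_natSinv_lt (PosNum (divr_gt0 e0 (ltr0Sn R 1))).
    by case=> k _ /(_ k (leqnn k)) /=; exists k.
  pose r : R := k.+1%:R^-1.
  have r0 : 0 < r by rewrite /r invr_gt0.
  have : forall j, exists a : rat, ratr a \in `](consrV xv ord0 j - r), (consrV xv ord0 j + r)[.
    move=> j; apply: rat_in_itvoo.
    by rewrite ltrBlDr -addrA ltrDl addr_gt0.
  move=> /choice[a aP].
  have xa : ball (c (\row_j a j, k)) r (consrV xv).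
    split => // i j; rewrite [i]ord1 [c _ _ _]mxE mxE.
    have := aP j; rewrite in_itv/= => /andP[a1 a2].
    by rewrite -ball_normE /= ltr_distl -ltrBlDr a1 ltrBlDr a2.
  exists (\row_j a j, k) => //; split => //=.
  move=> y ya; apply: eU.
  have : ball (consrV xv) (r + r) y.
    by apply: ball_triangle ya; exact: ball_sym.
  by apply: le_ball; rewrite [leRHS]splitr ltW// ltrD.
apply: countable_bigcupT_measurable => // i.
have [iU|iU] := pselect (ball (c i) i.2.+1%:R^-1 `<=` U); last first.
  by rewrite [F i](_ : _ = set0)//; apply/seteqP; split => // ? [].
rewrite [F i](_ : _ = @consrV n @^-1` ball (c i) i.2.+1%:R^-1); last first.
  by apply/seteqP; split => [? []|].
rewrite consrV_ball ?invr_gt0//; apply: measurableX.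
  exact: measurable_realfun.measurable_ball.
by apply: measurable_openrV; exact: ball_open.
Qed.

Local Open Scope ereal_scope.

(* Lebesgue measure on R^n, by slicing along the first coordinate *)
Fixpoint lebesgue_measure_rV n : set 'rV[R]_n -> \bar R :=
  match n with
  | 0 => fun A => \d_(0%R : 'rV[R]_0) A
  | n'.+1 => fun A => \int[@lebesgue_measure R]_x
      lebesgue_measure_rV [set v : 'rV[R]_n' | A (row_mx x%:M v)]
  end.

Let ball_sigma_finite n (f : set 'rV[R]_n -> \bar R) :
  (forall k, f (ball 0%R k.+1%:R) < +oo) -> sigma_finite setT f.
Proof.
move=> foo; exists (fun k => ball (0 : 'rV[R]_n)%R k.+1%:R).
  apply/esym; rewrite -subTset => x _.
  exists (Num.truncn `|x|) => //=.
  by rewrite -ball_normE /= sub0r normrN truncnS_gt.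
by move=> k; split => //; apply: measurable_openrV; exact: ball_open.
Qed.

Let lebesgue_measure_rVP n :
  exists2 mu : {sigma_finite_measure set 'rV[R]_n -> \bar R},
    @lebesgue_measure_rV n = mu & forall k, mu (ball 0%R k.+1%:R) < +oo.
Proof.
elim: n => [|n [mu muE muoo]].
  exists \d_(0%R : 'rV[R]_0) => //= k.
  by rewrite diracE ltry.
pose nu : {measure set 'rV[R]_n.+1 -> \bar R} :=
  measure_function_pushforward__canonical__measure_function_Measure
   (@lebesgue_measure R \x mu) (@measurable_consrV n).
have nuE : @lebesgue_measure_rV n.+1 = nu.
  apply/funext => A /=; rewrite /pushforward /product_measure1.
  apply: eq_integral => x _ /=; rewrite muE; congr (mu _).
  by apply/seteqP; split => v; rewrite /xsection /= inE.
have nuoo k : nu (ball 0%R k.+1%:R) < +oo.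
  rewrite /nu /= /pushforward consrV_ball ?ltr0n// product_measure1E//.
  - apply: lte_mul_pinfty => //.
      by rewrite [X in X \is a _]lebesgue_measure_ball.
    by rewrite (_ : \row_j _ = 0)%R//; apply/rowP => j; rewrite !mxE.
  - exact: measurable_realfun.measurable_ball.
  - by apply: measurable_openrV; exact: ball_open.
pose nu' : {sigma_finite_measure set 'rV[R]_n.+1 -> \bar R} :=
  HB.pack_for {sigma_finite_measure set 'rV[R]_n.+1 -> \bar R}
    (Measure.sort nu)
    (isSigmaFinite.Build _ _ _ nu (ball_sigma_finite nuoo))
    (isSFinite.Build _ _ _ nu
      (sfinite_measure_sigma_finite (ball_sigma_finite nuoo))).
by exists nu'.
Qed.

Let lebesgue_measure_rV0 n : @lebesgue_measure_rV n set0 = 0.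
Proof. by have [mu -> _] := lebesgue_measure_rVP n. Qed.

Let lebesgue_measure_rV_ge0 n A : 0 <= @lebesgue_measure_rV n A.
Proof. by have [mu -> _] := lebesgue_measure_rVP n. Qed.

Let lebesgue_measure_rV_semi_sigma_additive n :
  semi_sigma_additive (@lebesgue_measure_rV n).
Proof.
have [mu -> _] := lebesgue_measure_rVP n.
exact: measure_semi_sigma_additive.
Qed.

Let lebesgue_measure_rV_sigma_finite n :
  sigma_finite setT (@lebesgue_measure_rV n).
Proof.
have [mu -> _] := lebesgue_measure_rVP n.
exact: sigma_finiteT.
Qed.

HB.instance Definition _ n := isMeasure.Build _ _ _ (@lebesgue_measure_rV n)
  (lebesgue_measure_rV0 n) (@lebesgue_measure_rV_ge0 n)
  (@lebesgue_measure_rV_semi_sigma_additive n).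

HB.instance Definition _ n := Measure_isSigmaFinite.Build _ _ _
  (@lebesgue_measure_rV n) (@lebesgue_measure_rV_sigma_finite n).

End lebesgue_measure_rV.
Arguments lebesgue_measure_rV : clear implicits.

Section cubes.
Context (R : realType) (m : nat).

Definition open_unit_cube : set 'rV[R]_m :=
  [set x | forall i, 0 < x ord0 i < 1].

Definition closed_unit_cube : set 'rV[R]_m :=
  [set x | forall i, 0 <= x ord0 i <= 1].

Definition half_open_unit_cube : set 'rV[R]_m :=
  [set x | forall i, 0 < x ord0 i <= 1].

Definition dyadic_cube (n : nat) (l : 'I_m -> int) : set 'rV[R]_m :=
  [set x | forall k, (l k)%:~R / 2 ^+ n < x ord0 k <= (l k + 1)%:~R / 2 ^+ n].

End cubes.
Arguments open_unit_cube : clear implicits.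
Arguments closed_unit_cube : clear implicits.
Arguments half_open_unit_cube : clear implicits.

Section sobolev.
Context {R : realType} {m : nat}.
Implicit Types (Omega : set 'rV[R]_m) (f g phi : 'rV[R]_m -> R).

Local Notation Lambda := (lebesgue_measure_rV R m).

Definition partial (i : 'I_m) f : 'rV[R]_m -> R :=
  fun x => 'D_(delta_mx ord0 i) f x.

Definition smooth f := forall s : seq 'I_m,
  let g := foldr partial f s in
  continuous g /\ forall x i, derivable g x (delta_mx ord0 i).

Definition multi_partial (k : 'I_m -> nat) f : 'rV[R]_m -> R :=
  foldr (fun i g => iter (k i) (partial i) g) f (enum 'I_m).

Definition mi_order (k : 'I_m -> nat) : nat := (\sum_(i < m) k i)%N.

Definition test_function Omega phi := smooth phi /\
  let supp := closure [set x | phi x != 0] in compact supp /\ supp `<=` Omega.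

Definition locally_integrable_on Omega f :=
  measurable_fun Omega f /\
  forall K, K `<=` Omega -> compact K -> Lambda.-integrable K (EFin \o f).

Definition is_weak_derivative Omega (k : 'I_m -> nat) f g :=
  locally_integrable_on Omega g /\
  forall phi, test_function Omega phi ->
    \int[Lambda]_(x in Omega) (f x * multi_partial k phi x) =
    (-1) ^+ mi_order k * \int[Lambda]_(x in Omega) (g x * phi x).

(* Weak derivatives are unique up to a Lebesgue-null subset of Omega; xget
   selects one of them. *)
Definition weak_derivative Omega (k : 'I_m -> nat) f : 'rV[R]_m -> R :=
  xget (cst 0) [set g | is_weak_derivative Omega k f g].

Definition Lp_on Omega (p : R) f := f \_ Omega \in Lfun Lambda p%:E.

Definition Lp_norm_on Omega (p : R) f : \bar R :=
  'N[Lambda]_p%:E[EFin \o (f \_ Omega)]%E.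

Definition sobolev Omega (l : nat) (p : R) : set ('rV[R]_m -> R) :=
  [set f | Lp_on Omega p f /\ forall k, (mi_order k <= l)%N ->
     exists2 g, is_weak_derivative Omega k f g & Lp_on Omega p g].

(* The multi-indices of order l, all of whose entries are at most l, are
   enumerated by the finite type {ffun 'I_m -> 'I_l.+1}. *)
Definition gradient_norm Omega (l : nat) f : 'rV[R]_m -> R := fun x =>
  Num.sqrt (\sum_(k : {ffun 'I_m -> 'I_l.+1} | mi_order (fun i => k i) == l)
    weak_derivative Omega (fun i => k i) f x ^+ 2).

Definition sobolev_norm Omega (l : nat) (p : R) f : \bar R :=
  (Lp_norm_on Omega p f + Lp_norm_on Omega p (gradient_norm Omega l f))%E.

(* The unit sphere of W_p^l of the unit cube, each element being given by its
   representative that is continuous on the closed cube (the values outside the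
   closed cube are unconstrained). *)
Definition sobolev_sphere (l : nat) (p : R) : set ('rV[R]_m -> R) :=
  let Omega := open_unit_cube R m in
  [set f | [/\ sobolev Omega l p f,
     {within closed_unit_cube R m, continuous f} &
     sobolev_norm Omega l p f = 1%E]].

End sobolev.

Section kolmogorov.
Context {R : realType} {V : lmodType R}.
Local Open Scope ereal_scope.

(* Linear subspaces of dimension at most n: the spans of n vectors *)
Definition subspaces_dim_le (n : nat) : set (set V) :=
  [set [set (\sum_(i < n) c i *: e i)%R | c in [set: 'I_n -> R]]
    | e in [set: 'I_n -> V]].

(* The diameter is unchanged when V is replaced by its quotient by the kernel of
   nrm, so a seminorm may be used for nrm. *)
Definition kolmogorov_diameter (nrm : V -> \bar R) (K : set V) (n : nat)
    : \bar R :=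
  ereal_inf [set ereal_sup [set ereal_inf [set nrm (x - y)%R | y in S]
    | x in K] | S in subspaces_dim_le n].

Definition upper_approximation_order (nrm : V -> \bar R) (K : set V)
    : \bar R :=
  limn_esup (fun n => lne (kolmogorov_diameter nrm K n) / (ln n%:R)%:E).

End kolmogorov.

Section spectrum.
Context {R : realType} {m : nat}.
Context (nu : {measure set 'rV[R]_m -> \bar R}).
Local Open Scope ereal_scope.

Definition dyadic_cubes (n : nat) : set (set 'rV[R]_m) :=
  [set Q | (exists l, Q = dyadic_cube n l) /\ 0 < nu Q].

Definition beta_at (n : nat) (s : R) : \bar R :=
  lne (\esum_(C in dyadic_cubes n) (nu C `^ s)) / (ln (2 ^+ n))%:E.

Definition Lq_spectrum (s : R) : \bar R := limn_esup (beta_at ^~ s).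

Definition spectral_exponent (b : R) : \bar R :=
  ereal_inf [set s%:E | s in
    [set s : R | (0 < s)%R /\ Lq_spectrum s - (b * s)%:E <= 0]].

End spectrum.

Lemma exponent_ge1 (R : realType) (p q : R) :
  1 < p -> p <= q -> (1 <= q%:E)%E.
Proof. by move=> p1 pq; rewrite lee_fin (le_trans (ltW p1)). Qed.

Section Lq_nu.
Context {R : realType} {m : nat}.
Context (nu : {measure set 'rV[R]_m -> \bar R}) (q : R).
Context (q1 : (1 <= q%:E)%E).

Definition Lq_norm (f : LfunType nu q1) : \bar R := 'N[nu]_q%:E[EFin \o f]%E.

(* LfunType consists of functions, not of classes modulo nu-a.e. equality, so
   all representatives are collected. *)
Definition sobolev_sphere_in_Lq (l : nat) (p : R) : set (LfunType nu q1) :=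
  [set g | exists2 f, sobolev_sphere l p f &
    {ae nu, forall x, (g : 'rV[R]_m -> R) x = f x}].

End Lq_nu.
Arguments Lq_norm {R m} nu {q} q1 f.
Arguments sobolev_sphere_in_Lq {R m} nu {q} q1 l p _.

(* Main.v *)
Require Import Defs.
From HB Require Import structures.
From mathcomp Require Import all_boot all_order all_algebra.
From mathcomp Require Import all_classical all_reals all_analysis.
From mathcomp Require Import measurable_realfun ring lra zify.
(** The embedding of the Sobolev sphere into L^q(nu) is approximated by functions
    that are polynomials of coordinate degree less than l on each cell of a
    dyadic partition of the cube, and the partition is adapted to nu.

    _Local estimate._ On a cube with corner c and side r contained in the unit
    cube, every continuous f in W_p^l satisfies
      |f - P| <= C r^(l - m/p) (int_Q |grad_l f|^p)^(1/p)
    for some polynomial P of coordinate degrees less than l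
    ([local_approximation]).  Let E be a smooth step from 0 to 1 on the line and
      k_{u,a,h} = (d/ds)^l [ (s - u)^(l-1)/(l-1)! E((s - a)/h) ].
    This kernel is supported in [a, a + h], has integral 1, is of size 1/h, and
    depends on u polynomially, with degree less than l.  Two such kernels with
    the same u differ by the l-th derivative of a function with compact support,
    because the two steps agree outside a compact interval; the size of that
    function is h^(l-1).  Take the product over the coordinates, with u = x_i,
    on the cubes Q_j obtained from Q by the homotheties of centre x and ratio
    2^-j, and integrate it against f.  For j = 0 this is a polynomial in x, and
    for j tending to infinity it tends to f(x).  Passing from j to j + 1 one
    coordinate at a time, each change of kernel is an l-th partial derivative of
    a test function, so that the definition of the weak derivative and the
    inequality of Hoelder bound the change of the integral by a multiple of
    (2^-j r)^(l - m/p) (int_Q |grad_l f|^p)^(1/p).  As l - m/p > 0, the bounds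
    form a convergent geometric series.

    _Partition._ Give a dyadic cell Q of side 2^-n the weight
    J(Q) = nu(Q) 2^(-n rho), which does not increase when Q is replaced by a
    subcell.  For a threshold t, the maximal cells with J(Q) < t partition the
    cube ([selected_disjoint], [selected_cover]).  The local estimate on each of
    them, with sum_Q int_Q |grad_l f|^p <= 1 and q >= p, gives an L^q(nu) error of
    at most C t^(1/q) on the whole Sobolev sphere, so that
    d_n <= C t^(1/q) as soon as n is at least l^m times the number of cells
    ([diameter_le]).

    _Counting._ Each selected cell is a child of a cell with J(Q) >= t.  If
    beta_nu(s) <= rho s and s' > s, then on each level the number of such cells
    is at most a constant times t^(-s') sum_Q J(Q)^s', and that sum is at most a
    constant times 2^(- n rho s') sum_Q nu(Q)^s, which decays geometrically in n.
    So there are at most K t^(-s') selected cells ([card_selected_le]).  Choosing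
    t of order n^(-1/s') gives d_n <= C' n^(-1/(q s')) and the order is at most
    -1/(q s') ([order_le]); it remains to let s' decrease to s_rho. *)

Set Implicit Arguments.
Unset Strict Implicit.
Unset Printing Implicit Defensive.
Import Order.TTheory GRing.Theory Num.Theory.
Import numFieldNormedType.Exports.
Local Open Scope classical_set_scope.
Local Open Scope ring_scope.

(** * Smooth cutoff functions on the line *)

Section smooth1.
Context {R : realType}.
Implicit Types f g u v : R -> R.

(** The derivatives are quantified existentially, so that the closure properties
    below are plain inductions that never compute an iterated derivative. *)
Fixpoint derivable_upto (n : nat) f : Prop :=
  if n is n'.+1 then
    exists2 g, (forall x : R, is_derive x 1 f (g x)) & derivable_upto n' g
  else True.

Definition smooth1 f := forall n, derivable_upto n f.

Lemma derivable_uptoW n f : derivable_upto n.+1 f -> derivable_upto n f.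
Proof.
elim: n f => [//|n IH] f [g fg gn]; exists g => //; exact: IH.
Qed.

Lemma derivable_uptoD n f g : derivable_upto n f -> derivable_upto n g ->
  derivable_upto n (fun x => f x + g x).
Proof.
elim: n f g => [//|n IH] f g [f' ff' fn] [g' gg' gn].
exists (fun x => f' x + g' x); last exact: IH.
by move=> x; have ? := ff' x; have ? := gg' x; apply: is_deriveD.
Qed.

Lemma derivable_uptoN n f : derivable_upto n f ->
  derivable_upto n (fun x => - f x).
Proof.
elim: n f => [//|n IH] f [f' ff' fn].
exists (fun x => - f' x); last exact: IH.
by move=> x; have ? := ff' x; apply: is_deriveN.
Qed.

Lemma derivable_uptoM n f g : derivable_upto n f -> derivable_upto n g ->
  derivable_upto n (fun x => f x * g x).
Proof.
elim: n f g => [//|n IH] f g fn1 gn1.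
have fn := derivable_uptoW fn1; have gn := derivable_uptoW gn1.
case: fn1 => f' ff' fn'; case: gn1 => g' gg' gn'.
exists (fun x => f x * g' x + g x * f' x); last first.
  by apply: derivable_uptoD; apply: IH.
by move=> x; have ? := ff' x; have ? := gg' x; apply: is_deriveM.
Qed.

Lemma derivable_uptoV n f : (forall x, f x != 0) -> derivable_upto n f ->
  derivable_upto n (fun x => (f x)^-1).
Proof.
move=> f0; elim: n => [//|n IH] fn1.
have fn := derivable_uptoW fn1.
case: fn1 => f' ff' fn'.
exists (fun x => - ((f x)^-1 * (f x)^-1 * f' x)); last first.
  apply: derivable_uptoN; apply: derivable_uptoM => //.
  by apply: derivable_uptoM; apply: IH.
move=> x; apply: is_derive_eq (is_deriveV (f0 x) (ff' x)) _.
by rewrite /GRing.scale/= mulNr expr2 invfM.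
Qed.

Lemma derivable_upto_cst n (c : R) : derivable_upto n (fun=> c).
Proof.
elim: n c => [//|n IH] c; exists (fun=> 0) => // x; exact: is_derive_cst.
Qed.

Lemma derivable_upto_affine n f (a b : R) : derivable_upto n f ->
  derivable_upto n (fun x => f (a * x + b)).
Proof.
elim: n f => [//|n IH] f [f' ff' fn].
exists (fun x => a * f' (a * x + b)); last first.
  apply: derivable_uptoM; [exact: derivable_upto_cst|exact: IH].
move=> x.
have h : is_derive x 1 (fun x : R => a * x + b) a.
  apply: is_derive_eq; rewrite /= /GRing.scale/=; ring.
have := ff' (a * x + b) => h'.
have -> : (fun x : R => f (a * x + b)) = f \o (fun x => a * x + b) by [].
rewrite mulrC.
exact: (@is_derive1_comp _ f (fun x => a * x + b)).
Qed.

Lemma smooth1_derive f : smooth1 f ->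
  (forall x : R, is_derive x 1 f (derive1 f x)) /\ smooth1 (derive1 f).
Proof.
move=> fs; have [g fg _] := fs 1%N.
have gE : derive1 f = g.
  by apply/funext => x; rewrite derive1E; have ? := fg x; rewrite derive_val.
rewrite gE; split => // n; have [g' fg' g'n] := fs n.+1.
suff -> : g = g' by [].
apply/funext => x; have h := fg x; have h' := fg' x.
by rewrite -(@derive_val _ _ _ _ _ _ _ h) -(@derive_val _ _ _ _ _ _ _ h').
Qed.

Lemma smooth1_derive1n f : smooth1 f ->
  forall n (x : R), is_derive x 1 (derive1n n f) (derive1n n.+1 f x).
Proof.
move=> fs n; suff : smooth1 (derive1n n f) by move/smooth1_derive => [].
by elim: n => [//|n /smooth1_derive[]].
Qed.

(** The exponential dominates each monomial through its Taylor series. *)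
Lemma horner_le_expR (q : {poly R}) :
  exists2 C, 0 <= C & forall t, 0 <= t -> `|q.[t]| <= C * expR t.
Proof.
exists (\sum_(i < size q) `|q`_i| * i`!%:R).
  by apply: sumr_ge0 => i _; rewrite mulr_ge0.
move=> t t0; rewrite horner_coef (le_trans (ler_norm_sum _ _ _))// mulr_suml.
apply: ler_sum => i _; rewrite normrM -mulrA ler_wpM2l// normrX ger0_norm//.
case: (nat_of_ord i) => [|n].
  by rewrite expr0 fact0 mul1r (le_trans _ (expR_ge1Dx t))// lerDl.
have := expR_ge1Dxn n t0; rewrite -lerBrDl => h.
rewrite -ler_pdivrMl ?ltr0n ?fact_gt0// mulrC (le_trans h)//.
by rewrite lerBlDr lerDl.
Qed.

(** The functions p(1/x) exp(-1/x), extended by 0: this family contains the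
    standard flat function and is closed under differentiation. *)
Definition flat (p : {poly R}) : R -> R :=
  fun x => if 0 < x then p.[x^-1] * expR (- x^-1) else 0.

Definition dflat (p : {poly R}) : {poly R} := 'X ^+ 2 * (p - p^`()).

(** At 0, domination of X^2 p by the exponential gives |flat p h| <= C h^2, hence
    a zero derivative. *)
Lemma flat_is_derive p (x : R) : is_derive x 1 (flat p) (flat (dflat p) x).
Proof.
have [x0|x0|->] := ltgtP x 0.
- rewrite {2}/flat ltNge (ltW x0)/=.
  apply: (@near_eq_is_derive _ _ _ (fun=> 0)) => //.
  near=> y; rewrite /flat ltNge ltW//=.
  by near: y; exact: lt_nbhsl.
- rewrite {2}/flat x0.
  pose f (y : R) := p.[y^-1] * expR (- y^-1).
  apply: (@near_eq_is_derive _ _ _ f) => //.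
    near=> y; rewrite /flat ifT//.
    by near: y; exact: lt_nbhsr.
  have xn0 : x != 0 by rewrite gt_eqF.
  have h1 : is_derive x 1 (fun y : R => y^-1) (- x ^- 2).
    apply: is_derive_eq (is_deriveV xn0 (is_derive_id x 1)) _.
    by rewrite /GRing.scale/= mulr1.
  have h2 : is_derive x 1 (fun y : R => p.[y^-1]) (- x ^- 2 * p^`().[x^-1]).
    have -> : (fun y : R => p.[y^-1]) = (horner p) \o (fun y => y^-1) by [].
    by apply: is_derive_eq; rewrite /GRing.scale/= mulrC.
  have h3 : is_derive x 1 (fun y : R => expR (- y^-1)) (x ^- 2 * expR (- x^-1)).
    have -> : (fun y : R => expR (- y^-1)) = expR \o (fun y => - y^-1) by [].
    by apply: is_derive_eq; rewrite /GRing.scale/= opprK mulrC.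
  apply: is_derive_eq.
  rewrite /GRing.scale/= /dflat !hornerE /= exprVn; ring.
- rewrite {2}/flat ltxx.
  have [C C0 HC] := horner_le_expR ('X^2 * p).
  have bnd (h : R) : `|flat p h| <= C * h ^+ 2.
    rewrite /flat; case: ifPn => [h0|_]; last by rewrite normr0 mulr_ge0// sqr_ge0.
    have := HC h^-1; rewrite invr_ge0 (ltW h0) => /(_ isT).
    rewrite !hornerE normrM (ger0_norm (sqr_ge0 _)) exprVn => H.
    rewrite normrM (gtr0_norm (expR_gt0 _)) expRN.
    rewrite ler_pdivrMr ?expR_gt0//.
    move: H; rewrite mulrC ler_pdivrMr ?exprn_gt0//.
    by rewrite expr2 mulrAC mulrA.
  have lim0 : (fun h : R => h^-1 *: ((flat p \o shift 0) (h *: 1) - flat p 0)) @ 0^'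
      --> (0 : R).
    apply/cvgrPdist_le => e e0.
    near=> h.
    rewrite sub0r normrN /= addr0 {2}/flat ltxx subr0 /GRing.scale/= mulr1.
    have hn0 : h != 0 by near: h; exact: nbhs_dnbhs_neq.
    rewrite normrM normfV ler_pdivrMl ?normr_gt0//.
    rewrite (le_trans (bnd h))// -real_normK ?num_real// expr2 mulrCA.
    rewrite ler_wpM2l//.
    have : `|h| <= e / (C + 1).
      by near: h; apply: dnbhs0_le; rewrite divr_gt0// ltr_wpDl.
    rewrite ler_pdivlMr ?ltr_wpDl// mulrC; apply: le_trans.
    by rewrite ler_wpM2r// lerDl.
  split; last first.
    by apply/cvg_lim => //; exact: lim0.
  by apply/cvg_ex; exists 0.
Unshelve. all: by end_near.
Qed.

Lemma smooth1_flat p : smooth1 (flat p).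
Proof.
by move=> n; elim: n p => [//|n IH] p; exists (flat (dflat p)) => //; exact: flat_is_derive.
Qed.

Lemma is_derive_unique f (x d d' : R) :
  is_derive x 1 f d -> is_derive x 1 f d' -> d = d'.
Proof. by move=> h h'; rewrite -(@derive_val _ _ _ _ _ _ _ h) derive_val. Qed.

(** The derivatives of the step vanish wherever it is locally constant; this is
    how its flat parts are handled at every order at once. *)
Lemma is_derive_near_cst f (x c d : R) :
  (\near x, f x = c) -> is_derive x 1 f d -> d = 0.
Proof.
move=> fc fd; apply: is_derive_unique fd _.
apply: (@near_eq_is_derive _ _ _ (fun=> c)) => //.
by near do apply/esym.
Unshelve. all: by end_near. Qed.

(** With a, b the flat functions of x - 1/4 and 3/4 - x, the quotient a/(a + b) is
    a step: the denominator never vanishes since 1/4 < 3/4.  The result is given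
    as the sequence of all derivatives, which are bounded because they vanish
    outside a segment. *)
Lemma smooth_step : exists E : nat -> R -> R,
  [/\ forall n (x : R), is_derive x 1 (E n) (E n.+1 x),
      forall x, x < 4^-1 -> E 0%N x = 0,
      forall x, 3 / 4 < x -> E 0%N x = 1,
      forall n x, x < 4^-1 \/ 3 / 4 < x -> E n.+1 x = 0 &
      forall n, exists M, forall x, `|E n x| <= M].
Proof.
(* Both arguments are written in the form A * x + B of the affine substitution. *)
pose a x := flat 1 (1 * x + - (4^-1 : R)).
pose b x := flat 1 (- 1 * x + (3 / 4 : R)).
have flat_ge0 x : 0 <= flat (1 : {poly R}) x.
  by rewrite /flat; case: ifP => // _; rewrite hornerE mul1r expR_ge0.
have flat_gt0 x : 0 < x -> 0 < flat (1 : {poly R}) x.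
  by move=> x0; rewrite /flat x0 hornerE mul1r expR_gt0.
have a0 x : x <= 4^-1 -> a x = 0 by move=> x4; rewrite /a /flat ifF//; lra.
have b0 x : 3 / 4 <= x -> b x = 0 by move=> x4; rewrite /b /flat ifF//; lra.
have ab_gt0 x : 0 < a x + b x.
  have [x4|x4] := leP x 4^-1.
    by rewrite ltr_wpDl ?flat_ge0// flat_gt0//; lra.
  by rewrite ltr_pwDl ?flat_ge0// flat_gt0//; lra.
pose e x := a x * (a x + b x)^-1.
have e_smooth : smooth1 e.
  move=> n; have ha : derivable_upto n a.
    exact: derivable_upto_affine (@smooth1_flat 1 n).
  have hb : derivable_upto n b.
    exact: derivable_upto_affine (@smooth1_flat 1 n).
  apply: derivable_uptoM => //; apply: derivable_uptoV => [x|].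
    by rewrite gt_eqF.
  exact: derivable_uptoD.
have eD := smooth1_derive1n e_smooth.
have e0 x : x < 4^-1 -> e x = 0 by move=> x4; rewrite /e a0 ?mul0r// ltW.
have e1 x : 3 / 4 < x -> e x = 1.
  move=> x4; rewrite /e b0 ?addr0 ?divff//; last exact: ltW.
  by have := ab_gt0 x; rewrite b0 ?addr0; [move/gt_eqF->|exact: ltW].
have eS n x : x < 4^-1 \/ 3 / 4 < x -> derive1n n.+1 e x = 0.
  have eS' : forall c (A : set R), open A -> (forall x, A x -> e x = c) ->
      forall n x, A x -> derive1n n.+1 e x = 0.
    move=> c A oA Ac; elim=> [|k IH] y Ay; apply: is_derive_near_cst (eD _ _).
      by near=> z; apply: Ac; near: z; exact: open_nbhs_nbhs.
    by near=> z; apply: IH; near: z; exact: open_nbhs_nbhs.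
  by case; [apply: (eS' 0 _ (@open_lt R _))|apply: (eS' 1 _ (@open_gt R _))].
exists (fun n => derive1n n e); split => // -[|n].
  exists 1 => x; rewrite ger0_norm /e.
    by rewrite ler_pdivrMr// mul1r lerDl flat_ge0.
  by rewrite divr_ge0 ?flat_ge0 ?ltW.
have [||c _ cP] := @EVT_max R (fun x => `|derive1n n.+1 e x|) 4^-1 (3 / 4).
- by lra.
- apply: continuous_subspaceT => x; apply: continuous_comp.
    apply: differentiable_continuous; apply/derivable1_diffP.
    by have [] := eD n.+1 x.
  exact: norm_continuous.
- exists `|derive1n n.+1 e c| => x.
  have [x4|x4] := ltP x 4^-1; first by rewrite eS ?normr0//; left.
  have [x3|x3] := ltP (3 / 4) x; first by rewrite eS ?normr0//; right.
  by apply: cP; rewrite in_itv/= x4 x3.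
Unshelve. all: by end_near. Qed.

End smooth1.

(** * Averaging kernels on the line *)

Section kernel.
Context {R : realType}.
Implicit Types (F G : nat -> R -> R).

(** A smooth function given together with its successive derivatives. *)
Definition jet F := forall n (x : R), is_derive x 1 (F n) (F n.+1 x).

Definition step_jet (E : nat -> R -> R) :=
  [/\ jet E,
      forall x, x < 4^-1 -> E 0%N x = 0,
      forall x, 3 / 4 < x -> E 0%N x = 1,
      forall n x, x < 4^-1 \/ 3 / 4 < x -> E n.+1 x = 0 &
      forall n, exists M, forall x, `|E n x| <= M].

Lemma jet_continuous F n : jet F -> continuous (F n).
Proof.
move=> jF x; apply: differentiable_continuous; apply/derivable1_diffP.
by have [] := jF n x.
Qed.

Lemma jet_shift F k : jet F -> jet (fun n => F (k + n)%N).
Proof. by move=> jF n x; rewrite addnS; exact: jF. Qed.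

Lemma jetB F G : jet F -> jet G -> jet (fun n x => F n x - G n x).
Proof.
by move=> jF jG n x; have ? := jF n x; have ? := jG n x; exact: is_deriveB.
Qed.

(** The n-th derivative of a product, in terms of the two jets. *)
Definition leibniz F G n (s : R) :=
  \sum_(i < n.+1) 'C(n, i)%:R * (F i s * G (n - i)%N s).

Lemma leibniz_jet F G : jet F -> jet G -> jet (leibniz F G).
Proof.
move=> jF jG n x.
pose D i := F i.+1 x * G (n - i)%N x + F i x * G (n - i).+1 x.
have H : is_derive x 1 (leibniz F G n) (\sum_(i < n.+1) 'C(n, i)%:R * D i).
  have -> : leibniz F G n =
      \sum_(i < n.+1) (fun s => 'C(n, i)%:R * (F i s * G (n - i)%N s)).
    by apply/funext => s; rewrite /leibniz fct_sumE.
  apply: is_derive_sum => i.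
  have ? := jF i x; have ? := jG (n - i)%N x.
  by apply: is_derive_eq; rewrite /D /GRing.scale/=; ring.
apply: is_derive_eq H _; rewrite /leibniz.
rewrite [RHS]big_ord_recl /= bin0 mul1r subn0.
under [in RHS]eq_bigr => i _.
  rewrite /bump/= add1n subSS binS natrD mulrDl; over.
rewrite big_split/= addrA addrC.
rewrite /D; under eq_bigr => i _ do rewrite mulrDr.
rewrite big_split/=; congr (_ + _).
rewrite big_ord_recl /= bin0 mul1r subn0; congr (_ + _).
rewrite [RHS]big_ord_recr/= bin_small// mul0r addr0.
by apply: eq_bigr => i _; rewrite /bump/= add1n subnSK.
Qed.

(** The i-th derivative of (s - u)^k / k!; beyond the degree it is 0, whereas the
    truncated exponent k - i would give 1. *)
Definition taylor_monomial (k : nat) (u : R) (i : nat) (s : R) :=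
  if (i <= k)%N then (s - u) ^+ (k - i) / (k - i)`!%:R else 0.

Lemma taylor_monomial_jet k u : jet (taylor_monomial k u).
Proof.
move=> i x; rewrite /taylor_monomial; have [ik|ki|->] := ltngtP i k.
- have -> : (k - i = (k - i.+1).+1)%N by lia.
  set n := (k - i.+1)%N.
  have h : is_derive x 1 (fun s : R => s - u) 1.
    by apply: is_derive_eq; rewrite subr0.
  have h2 : is_derive x 1 (fun s : R => (s - u) ^+ n.+1 / n.+1`!%:R)
      (n.+1`!%:R^-1 *: (n.+1%:R * (x - u) ^+ n)).
    have -> : (fun s : R => (s - u) ^+ n.+1 / n.+1`!%:R) =
        n.+1`!%:R^-1 *: ((fun s : R => s - u) ^+ n.+1).
      apply/funext => s; rewrite mulrC; congr (_ * _).
      by elim: n.+1 => [|j IH]; rewrite ?expr0// !exprS IH.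
    apply: is_derive_eq; rewrite /GRing.scale/= mulr1//.
  apply: is_derive_eq h2 _; rewrite /GRing.scale/= factS natrM invfM.
  rewrite mulrACA mulVf ?mul1r; last by rewrite pnatr_eq0.
  by rewrite mulrC.
- exact: is_derive_cst.
- rewrite subnn.
  have -> : (fun s : R => (s - u) ^+ 0 / 0`!%:R) = (fun=> 1).
    by apply/funext => s; rewrite expr0 fact0 divr1.
  exact: is_derive_cst.
Qed.

Definition rescale (E : nat -> R -> R) (a h : R) n (s : R) :=
  h ^- n * E n ((s - a) / h).

Lemma rescale_jet E a h : jet E -> jet (rescale E a h).
Proof.
move=> jE n x; have jx := jE n ((x - a) / h).
have H : is_derive x 1 (fun s : R => (s - a) / h) h^-1.
  have -> : (fun s : R => (s - a) / h) = (fun s => h^-1 *: (s - a)).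
    by apply/funext => s; rewrite /GRing.scale/= mulrC.
  by apply: is_derive_eq; rewrite /GRing.scale/= subr0 mulr1.
have H2 := @is_derive1_comp _ (E n) (fun s => (s - a) / h) x _ _ jx H.
have -> : rescale E a h n = (fun s => h ^- n *: (E n \o (fun s => (s - a) / h)) s).
  by [].
apply: is_derive_eq; rewrite /GRing.scale/= /rescale exprS invfM; ring.
Qed.

(** The jet of W(s) = (s - u)^k / k! E((s - a)/h).  Its entry of index k.+1 is the
    averaging kernel: it vanishes where W is 0 and where W is a polynomial of
    degree k. *)
Definition kernel_jet E k (u a h : R) :=
  leibniz (taylor_monomial k u) (rescale E a h).

Lemma kernel_jetP E k u a h : jet E -> jet (kernel_jet E k u a h).
Proof.
by move=> jE; apply: leibniz_jet; [exact: taylor_monomial_jet|exact: rescale_jet].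
Qed.

Section bounds.
Context (E : nat -> R -> R) (k : nat) (u a h : R).
Context (sE : step_jet E) (h0 : 0 < h).

Lemma rescale_left n s : s < a + h / 4 -> rescale E a h n s = 0.
Proof.
case: sE => _ El _ ES _ sah; rewrite /rescale.
have s4 : (s - a) / h < 4^-1 by rewrite ltr_pdivrMr//; lra.
by case: n => [|n]; [rewrite El ?mulr0|rewrite ES ?mulr0//; left].
Qed.

Lemma rescale_right n s : a + 3 / 4 * h < s ->
  rescale E a h n s = (n == 0)%:R.
Proof.
case: sE => _ _ Er ES _ sah; rewrite /rescale.
have s4 : 3 / 4 < (s - a) / h by rewrite ltr_pdivlMr//; lra.
case: n => [|n]; first by rewrite Er// expr0 invr1 mulr1.
by rewrite ES ?mulr0//; right.
Qed.

Lemma kernel_left n s : s < a + h / 4 -> kernel_jet E k u a h n s = 0.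
Proof.
by move=> sa; rewrite /kernel_jet /leibniz big1// => i _; rewrite rescale_left ?mulr0.
Qed.

Lemma kernel_right n s : a + 3 / 4 * h < s ->
  kernel_jet E k u a h n s = taylor_monomial k u n s.
Proof.
move=> sa; rewrite /kernel_jet /leibniz big_ord_recr/= big1 ?add0r.
  by rewrite binn mul1r subnn rescale_right// mulr1.
move=> i _; rewrite rescale_right// subn_eq0 leqNgt ltn_ord/= mulr0.
by rewrite mulr0.
Qed.

Lemma kernel_supp n s : s < a + h / 4 \/ a + 3 / 4 * h < s ->
  kernel_jet E k u a h (k.+1 + n)%N s = 0.
Proof.
case=> [|sa]; first exact: kernel_left.
by rewrite kernel_right// /taylor_monomial ifF//; lia.
Qed.

Lemma taylor_monomial_le i s : (i <= k)%N -> `|s - u| <= h ->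
  `|taylor_monomial k u i s| <= h ^+ (k - i).
Proof.
move=> ik su; rewrite /taylor_monomial ik normrM normrX normfV normr_nat.
rewrite ler_pdivrMr ?ltr0n ?fact_gt0//.
apply: (@le_trans _ _ (h ^+ (k - i))); first by rewrite lerXn2r ?nnegrE// ltW.
by rewrite ler_peMr ?exprn_ge0 ?(ltW h0)// ler1n fact_gt0.
Qed.

(** The k-th derivative of W is an antiderivative of the kernel; it is 0 at the
    left end, where W = 0, and 1 at the right end, where W = (s - u)^k / k!. *)
Lemma kernel_integral :
  (\int[@lebesgue_measure R]_(x in `[a, (a + h)%R]) (kernel_jet E k u a h k.+1 x)%:E = 1)%E.
Proof.
have jk : jet (kernel_jet E k u a h) by apply: kernel_jetP; case: sE.
rewrite (@continuous_FTC2 _ _ (kernel_jet E k u a h k)).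
- have ah : a + 3 / 4 * h < a + h.
    by rewrite ltrD2l gtr_pMl// ltr_pdivrMr ?ltr0n// mul1r ltr_nat.
  have ah' : a < a + h / 4 by rewrite ltrDl divr_gt0.
  rewrite (kernel_right _ ah) (kernel_left _ ah').
  by rewrite /taylor_monomial leqnn subnn expr0 fact0 divr1 sube0.
- by rewrite ltrDl.
- exact/continuous_subspaceT/jet_continuous.
- split.
  + by move=> x _; have [] := jk k x.
  + exact/cvg_at_right_filter/jet_continuous.
  + exact/cvg_at_left_filter/jet_continuous.
- move=> x _; rewrite derive1E; have ? := jk k x; exact: derive_val.
Qed.

End bounds.

(** Each term of the Leibniz formula pairs (s - u)^(k-i) with a cutoff derivative
    of size h^-(k+1-i), and |s - u| <= h on the support. *)
Lemma kernel_bound E k : step_jet E -> exists2 C, 0 <= C & forall u a h,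
  0 < h -> a <= u <= a + h -> forall s, `|kernel_jet E k u a h k.+1 s| <= C / h.
Proof.
move=> sE; have [_ _ _ _ /choice[M EM]] := sE.
have M0 n : 0 <= M n by apply: le_trans (EM n 0).
exists (\sum_(i < k.+2) 'C(k.+1, i)%:R * M (k.+1 - i)%N).
  by apply: sumr_ge0 => i _; rewrite mulr_ge0.
move=> u a h h0 uah s.
have RHS0 : 0 <= (\sum_(i < k.+2) 'C(k.+1, i)%:R * M (k.+1 - i)%N) / h.
  by rewrite divr_ge0 ?(ltW h0)// sumr_ge0// => i _; rewrite mulr_ge0.
have [sl|sl] := ltP s (a + h / 4); first by rewrite kernel_left ?normr0.
have [sr|sr] := ltP (a + 3 / 4 * h) s.
  by rewrite -[k.+1]addn0 kernel_supp ?normr0 ?addn0//; right.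
have su : `|s - u| <= h by rewrite ler_norml; lra.
rewrite (le_trans (ler_norm_sum _ _ _))// mulr_suml.
apply: ler_sum => i _; rewrite normrM normr_nat -mulrA ler_wpM2l//.
have [ik|ki] := leqP i k; last first.
  by rewrite /taylor_monomial leqNgt ki/= mul0r normr0 divr_ge0 ?(ltW h0).
rewrite normrM (@le_trans _ _ (h ^+ (k - i) * (h ^- (k.+1 - i) * M (k.+1 - i)%N)))//.
  rewrite ler_pM// ?taylor_monomial_le// /rescale normrM ger0_norm ?invr_ge0 ?exprn_ge0 ?(ltW h0)//.
  by rewrite ler_wpM2l// ?invr_ge0 ?exprn_ge0 ?(ltW h0).
rewrite subSn// exprS invfM mulrA mulrCA divff ?mulr1 1?mulrC//.
by rewrite expf_neq0// gt_eqF.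
Qed.

(** Outside [a, a + h] the two cutoffs coincide, both being 0 or both being 1. *)
Lemma kernel_diff_bound E k : step_jet E -> exists2 C, 0 <= C & forall u a h a' h',
  0 < h -> 0 < h' -> a <= a' -> a' + h' <= a + h -> a <= u <= a + h ->
  forall s, `|kernel_jet E k u a' h' 0%N s - kernel_jet E k u a h 0%N s| <= C * h ^+ k.
Proof.
move=> sE; have [_ _ _ _ /(_ 0%N)[M EM]] := sE.
have M0 : 0 <= M by apply: le_trans (EM 0).
exists (M + M); first by rewrite addr_ge0.
move=> u a h a' h' h0 h'0 aa' ah' uah s.
have C0 : 0 <= (M + M) * h ^+ k by rewrite mulr_ge0 ?addr_ge0 ?exprn_ge0 ?(ltW h0).
have [sl|sl] := ltP s a.
  by rewrite !kernel_left ?subrr ?normr0//; lra.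
have [sr|sr] := ltP (a + h) s.
  by rewrite !kernel_right ?subrr ?normr0//; lra.
rewrite /kernel_jet /leibniz !big_ord1 !bin0 !mul1r -mulrBr normrM mulrC ler_pM//.
  rewrite /rescale !expr0 !invr1 !mul1r (le_trans (ler_normB _ _))// lerD//.
rewrite (le_trans (@taylor_monomial_le k u h h0 0%N s _ _)) ?subn0//.
by rewrite ler_norml; lra.
Qed.

(** The coefficient of u^b in the kernel, from the binomial expansion of
    (s - u)^(k-i). *)
Definition kernel_coef E k (a h : R) b (s : R) :=
  \sum_(i < k.+2) 'C(k.+1, i)%:R *
    ((if (i <= k)%N then
        'C(k - i, b)%:R * (-1) ^+ b * s ^+ (k - i - b) / (k - i)`!%:R
      else 0) * rescale E a h (k.+1 - i)%N s).

(** The kernel is a polynomial of degree at most k in the base point u: this makes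
    the average of f over a fixed cube a polynomial of the base point. *)
Lemma kernel_coefE E k u a h s :
  kernel_jet E k u a h k.+1 s = \sum_(b < k.+1) u ^+ b * kernel_coef E k a h b s.
Proof.
rewrite /kernel_jet /leibniz /kernel_coef.
under [RHS]eq_bigr => b _ do rewrite mulr_sumr.
rewrite exchange_big/=; apply: eq_bigr => i _.
under [RHS]eq_bigr => b _ do rewrite mulrCA.
rewrite -mulr_sumr; congr (_ * _).
under [RHS]eq_bigr => b _ do rewrite mulrA.
rewrite -mulr_suml; congr (_ * _).
rewrite /taylor_monomial; case: ifP => ik; last first.
  by rewrite big1// => b _; rewrite mulr0.
under [RHS]eq_bigr => b _ do rewrite mulrA.
rewrite -mulr_suml; congr (_ / _).
rewrite exprDn (big_ord_widen k.+1 (fun j => s ^+ (k - i - j) * (- u) ^+ j *+ 'C(k - i, j)))//; last by lia.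
rewrite big_mkcond/=; apply: eq_bigr => b _; case: ifPn => bk.
  rewrite (exprNn u) -[LHS]mulr_natl.
  move: ((-1) ^+ b) ('C(_, _)%:R : R) (u ^+ b) (s ^+ _) => e c x y; ring.
by rewrite bin_small ?mul0r ?mulr0//; lia.
Qed.

Lemma kernel_coef_continuous E k a h b : jet E -> continuous (kernel_coef E k a h b).
Proof.
move=> jE; rewrite /kernel_coef => x; apply: continuous_big => //.
  exact: add_continuous.
move=> i _ y; apply: cvgM; first exact: cvg_cst.
apply: cvgM; last exact/jet_continuous/rescale_jet.
case: ifP => _; last exact: cvg_cst.
apply: cvgM; last exact: cvg_cst.
apply: cvgM; first exact: cvg_cst.
exact: exprn_continuous.
Qed.

End kernel.

(** * Lebesgue measure on row vectors *)

Section lebesgue_rV.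
Context {R : realType}.
Local Notation Lambda n := (lebesgue_measure_rV R n).
Local Notation lambda := (@lebesgue_measure R).

Lemma open_measurable_rV n (A : set 'rV[R]_n) : open A -> measurable A.
Proof. exact: sub_sigma_algebra. Qed.

Lemma continuous_measurable_rV n (f : 'rV[R]_n -> R) : continuous f ->
  measurable_fun [set: 'rV[R]_n] f.
Proof.
move=> /continuousP cf; apply: (measurability _ (measurable_realfun.RGenOpens.measurableE R)).
move=> _ [_ [a [b ->] <-]]; rewrite setTI; apply: open_measurable_rV.
exact/cf/interval_open.
Qed.

Lemma measurable_coord n i : measurable_fun [set: 'rV[R]_n] (fun v => v ord0 i).
Proof. by apply: continuous_measurable_rV => x; exact: coord_continuous. Qed.

Lemma measurable_prod_coord n (f : 'I_n -> R -> R) :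
  (forall i, measurable_fun [set: R] (f i)) ->
  measurable_fun [set: 'rV[R]_n] (fun v => \prod_i f i (v ord0 i)).
Proof.
move=> mf; apply: measurable_prod => i _.
by apply: measurableT_comp => //; exact: measurable_coord.
Qed.

(** The inverse of the splitting of coordinates along which the measure on row
    vectors is defined by slicing; it transports the integral to a product
    measure. *)
Definition split_rV n (v : 'rV[R]_n.+1) : measurableTypeR R * 'rV[R]_n :=
  (v ord0 ord0, \row_j v ord0 (lift ord0 j)).

Lemma split_rVK n x (v : 'rV[R]_n) : split_rV (row_mx x%:M v) = (x, v).
Proof.
rewrite /split_rV; congr (_, _).
  rewrite (_ : ord0 = lshift n (ord0 : 'I_1)); last exact/val_inj.
  by rewrite (@row_mxEl _ 1 1 n) mxE eqxx mulr1n.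
apply/rowP => j; rewrite mxE (_ : lift ord0 j = rshift 1 j); last exact/val_inj.
by rewrite (@row_mxEr _ 1 1 n).
Qed.

Lemma measurable_split_rV n :
  measurable_fun [set: 'rV[R]_n.+1] (@split_rV n).
Proof.
apply: measurable_fun_pair; first exact: measurable_coord.
apply: (measurability (@open 'rV[R]_n)) => //.
move=> _ [U oU <-]; rewrite setTI; apply: open_measurable_rV.
suff : continuous (fun v : 'rV[R]_n.+1 => \row_j v ord0 (lift ord0 j)).
  by move/continuousP; exact.
move=> v A [P Pv PA].
exists (fun i j => if unlift ord0 j is Some k then P i k else setT).
  move=> i j; case: unliftP => [k jk|_]; last exact: filterT.
  by have := Pv i k; rewrite mxE jk [i]ord1.
move=> w Pw; apply: PA => i j; rewrite mxE.
by have := Pw i (lift ord0 j); rewrite liftK [i]ord1.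
Qed.

Lemma lebesgue_measure_rVS n (B : set (measurableTypeR R * 'rV[R]_n)) :
  pushforward (Lambda n.+1) (@split_rV n) B = (lambda \x Lambda n)%E B.
Proof.
rewrite /pushforward /=; rewrite /product_measure1.
apply: eq_integral => x _ /=; congr (lebesgue_measure_rV R n _).
apply/seteqP; split => v /=; rewrite split_rVK /xsection/= ?inE//.
Qed.

(** Induction on the dimension: [split_rV] pushes the measure forward to a product
    measure, where the theorem of Fubini separates the first coordinate. *)
Lemma integral_prod_coord n (f : 'I_n -> R -> R) :
  (forall i, lambda.-integrable setT (EFin \o f i)) ->
  (Lambda n).-integrable setT (fun v => (\prod_i f i (v ord0 i))%:E) /\
  \int[Lambda n]_v (\prod_i f i (v ord0 i)) = \prod_i \int[lambda]_x f i x.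
Proof.
elim: n f => [|n IH] f fi.
  have E : (fun v : 'rV[R]_0 => (\prod_(i < 0) f i (v ord0 i))%:E) = cst 1%:E.
    by apply/funext => v; rewrite big_ord0.
  have L0 : Lambda 0 setT = 1%E by rewrite /= diracT.
  split.
    rewrite E; apply/integrableP; split => //.
    rewrite (eq_integral (cst 1%E)) ?integral_cst// ?L0 ?mul1e ?ltry// => x _.
    by rewrite /= normr1.
  rewrite /Rintegral E integral_cst// mul1e.
  rewrite big_ord0.
  transitivity (fine (\d_(0%R : 'rV[R]_0) [set: 'rV[R]_0] : \bar R)) => //.
  by rewrite diracT.
have {IH}[Gi GE] := IH (fun i => f (lift ord0 i)) (fun i => fi _).
set G := fun v : 'rV[R]_n => \prod_i f (lift ord0 i) (v ord0 i) in Gi GE.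
pose F (z : measurableTypeR R * 'rV[R]_n) := (f ord0 z.1 * G z.2)%:E.
have FE : (fun v : 'rV[R]_n.+1 => (\prod_i f i (v ord0 i))%:E) = F \o @split_rV n.
  apply/funext => v; rewrite /F/= big_ord_recl /G; congr (_ * _)%:E.
  by apply: eq_bigr => i _; rewrite mxE.
have mf0 : measurable_fun setT (f ord0).
  by apply/measurable_EFinP; have /integrableP[] := fi ord0.
have mG : measurable_fun setT G.
  by apply/measurable_EFinP; have /integrableP[] := Gi.
have mF : measurable_fun setT F.
  by apply/measurable_EFinP; apply: measurable_funM; apply: measurableT_comp.
have Fi : (lambda \x Lambda n)%E.-integrable setT F.
  apply/integrableP; split => //.
  rewrite fubini_tonelli1//; last exact: measurableT_comp.
  have -> : fubini_F (Lambda n) (fun x => `|F x|%E) =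
      fun x => (`|f ord0 x|%:E * \int[Lambda n]_v `|(G v)%:E|)%E.
    apply/funext => x; rewrite /fubini_F /F/= -ge0_integralZl//.
    + by apply: eq_integral => v _; rewrite /= normrM EFinM.
    + by apply/measurable_EFinP/measurableT_comp.
  have /integrableP[_ Goo] := Gi.
  rewrite ge0_integralZr//; last 2 first.
    by apply/measurable_EFinP/measurableT_comp.
    exact: integral_ge0.
  have /integrableP[_ foo] := fi ord0.
  by rewrite lte_mul_pinfty// ?integral_ge0// ge0_fin_numE ?integral_ge0.
have pE : forall g, (\int[lambda \x Lambda n]_z g z =
    \int[pushforward (Lambda n.+1) (@split_rV n)]_z g z)%E.
  by move=> g; rewrite (funext (@lebesgue_measure_rVS n)).
have Fsi : (Lambda n.+1).-integrable setT (F \o @split_rV n).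
  apply/integrableP; split.
    by apply: measurableT_comp => //; exact: measurable_split_rV.
  have /integrableP[_] := Fi; rewrite pE.
  rewrite ge0_integral_pushforward ?preimage_setT//.
  - exact: measurable_split_rV.
  - exact: measurableT_comp.
split; first by rewrite FE.
rewrite big_ord_recl -GE {1}/Rintegral FE.
have := @integral_pushforward _ _ _ _ _ _ (@measurable_split_rV n) (Lambda n.+1) setT F mF.
rewrite preimage_setT => /(_ Fsi measurableT) <-.
rewrite -pE -integral12_prod_meas1//.
have Gfin : (\int[Lambda n]_v (G v)%:E)%E \is a fin_num by exact: integrable_fin_num.
have -> : fubini_F (Lambda n) F =
    fun x => ((f ord0 x)%:E * (fine (\int[Lambda n]_v (G v)%:E))%:E)%E.
  by apply/funext => x; rewrite fineK// /fubini_F /F/= -integralZl.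
have := @integralZr _ _ _ lambda setT measurableT _ (fi ord0) (fine (\int[Lambda n]_v (G v)%:E)).
by move=> /= ->; rewrite fineM//; exact: (integrable_fin_num measurableT (fi ord0)).
Qed.

Definition box n (A : 'I_n -> set R) : set 'rV[R]_n :=
  [set v | forall i, A i (v ord0 i)].

Lemma indic_box n (A : 'I_n -> set R) v :
  \1_(box A) v = \prod_i \1_(A i) (v ord0 i) :> R.
Proof.
rewrite indicE; have [|] := boolP (v \in box A).
  rewrite inE => vA; rewrite big1// => i _; rewrite indicE mem_set//; exact: vA.
rewrite notin_setE => /existsNP[i vAi]; rewrite (bigD1 i)//= indicE memNset//.
by rewrite mul0r.
Qed.

Lemma measurable_box n (A : 'I_n -> set R) :
  (forall i, measurable (A i)) -> measurable (box A).
Proof.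
move=> mA.
have -> : box A = (fun v : 'rV[R]_n => \prod_i (\1_(A i) (v ord0 i) : R)) @^-1` [set 1].
  apply/seteqP; split => v /=; rewrite -indic_box indicE.
    by move=> vA; rewrite mem_set.
  by have [/[!inE]//|_ /esym/eqP] := boolP (v \in box A); rewrite oner_eq0.
rewrite -[X in measurable X]setTI.
have m := measurable_prod_coord (fun i => measurable_indic (mA i)).
exact: m.
Qed.

Lemma lebesgue_measure_box n (A : 'I_n -> set R) :
  (forall i, measurable (A i)) -> (forall i, (lambda (A i) < +oo)%E) ->
  Lambda n (box A) = (\prod_i fine (lambda (A i)))%:E.
Proof.
move=> mA Aoo.
have [|] := @integral_prod_coord n (fun i => \1_(A i)).
  move=> i; apply/integrableP; split.
    have h := @measurable_indic _ _ R setT _ (mA i).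
    exact/measurable_EFinP.
  under eq_integral => v _ do rewrite /= ger0_norm//.
  rewrite integral_indic ?setIT//; [exact: Aoo|exact: mA].
have E : (fun v : 'rV[R]_n => (\prod_i (\1_(A i) (v ord0 i) : R))%:E) = EFin \o \1_(box A).
  by apply/funext => v; rewrite /= indic_box.
rewrite /Rintegral; rewrite E integral_indic ?setIT//; last exact: measurable_box.
move=> /integrableP[_]; rewrite (eq_integral (EFin \o \1_(box A))); last first.
  by move=> v _; rewrite /= ger0_norm.
rewrite integral_indic ?setIT//; last exact: measurable_box.
move=> boxoo; rewrite (eq_bigr (fun i => fine (lambda (A i)))); last first.
  by move=> i _; congr fine; rewrite integral_indic ?setIT//; exact: mA.
by move=> <-; rewrite fineK// ge0_fin_numE.
Qed.

End lebesgue_rV.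

(** * Products of one-variable functions *)

Section product_functions.
Context {R : realType} {m : nat}.
Implicit Types (F : 'I_m -> nat -> R -> R) (a : 'I_m -> nat) (v : 'rV[R]_m).

Definition prod_jet F a : 'rV[R]_m -> R := fun v => \prod_i F i (a i) (v ord0 i).

(** In the difference quotient along the i-th basis vector, only the i-th factor
    varies. *)
Lemma prod_jet_is_derive F a i v : (forall i, jet (F i)) ->
  is_derive v (delta_mx ord0 i) (prod_jet F a)
    (prod_jet F (fun j => a j + (j == i))%N v).
Proof.
move=> jF; set e := delta_mx _ _.
pose c := \prod_(j | j != i) F j (a j) (v ord0 j).
have E (h : R) : h^-1 *: ((prod_jet F a \o shift v) (h *: e) - prod_jet F a v) =
    (h^-1 *: ((F i (a i) \o shift (v ord0 i)) (h *: (1 : R)) - F i (a i) (v ord0 i))) * c.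
  rewrite /= /prod_jet (bigD1 i)//= [X in _ - X](bigD1 i)//= !mxE !eqxx.
  rewrite (eq_bigr (fun j => F j (a j) (v ord0 j))); last first.
    by move=> j ji; rewrite !mxE eqxx (negbTE ji) mulr0 add0r.
  by rewrite -/c -mulrBl /GRing.scale/= !mulr1 mulrA.
have [Fd FE] := jF i (a i) (v ord0 i).
have lim : h^-1 *: ((prod_jet F a \o shift v) (h *: e) - prod_jet F a v) @[h --> 0^'] -->
    F i (a i).+1 (v ord0 i) * c.
  under eq_fun do rewrite E.
  apply: cvgM; last exact: cvg_cst.
  by rewrite -FE; exact: Fd.
have -> : prod_jet F (fun j => a j + (j == i))%N v = F i (a i).+1 (v ord0 i) * c.
  rewrite /prod_jet (bigD1 i)//= eqxx addn1; congr (_ * _).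
  by apply: eq_bigr => j ji; rewrite (negbTE ji) addn0.
split; first by apply/cvg_ex; eexists; exact: lim.
exact/cvg_lim.
Qed.

Lemma partial_prod_jet F a i : (forall i, jet (F i)) ->
  partial i (prod_jet F a) = prod_jet F (fun j => a j + (j == i))%N.
Proof.
move=> jF; apply/funext => v; rewrite /partial.
by have h := prod_jet_is_derive a i v jF; rewrite derive_val.
Qed.

Lemma prod_jet_continuous F a : (forall i, jet (F i)) -> continuous (prod_jet F a).
Proof.
move=> jF v; apply: continuous_big; first exact: mul_continuous.
move=> i _ w; apply: (@continuous_comp _ _ _ (fun v : 'rV[R]_m => v ord0 i) (F i (a i))).
  exact: coord_continuous.
exact: jet_continuous.
Qed.

Lemma prod_jet_smooth F a : (forall i, jet (F i)) -> smooth (prod_jet F a).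
Proof.
move=> jF s /=.
have [b ->] : exists b, foldr partial (prod_jet F a) s = prod_jet F b.
  elim: s => [|i s [b IH]]; first by exists a.
  by exists (fun j => b j + (j == i))%N; rewrite /= IH partial_prod_jet.
split; first exact: prod_jet_continuous.
by move=> v i; have [] := prod_jet_is_derive b i v jF.
Qed.

(** Derivatives of a product of one-variable functions act factor by factor, which
    keeps all the test functions of the argument inside this class. *)
Lemma multi_partial_prod_jet F a (k : 'I_m -> nat) : (forall i, jet (F i)) ->
  multi_partial k (prod_jet F a) = prod_jet F (fun j => a j + k j)%N.
Proof.
move=> jF; have itE n i b : iter n (partial i) (prod_jet F b) =
    prod_jet F (fun j => b j + (j == i) * n)%N.
  elim: n => [|n IH] /=.
    by congr prod_jet; apply/funext => j; rewrite muln0 addn0.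
  rewrite IH partial_prod_jet//; congr prod_jet; apply/funext => j.
  by case: (j == i); lia.
have H s : uniq s -> foldr (fun i g => iter (k i) (partial i) g) (prod_jet F a) s =
    prod_jet F (fun j => a j + (j \in s) * k j)%N.
  elim: s => [_|i s IH /= /andP[iNs us]] /=.
    by congr prod_jet; apply/funext => j; rewrite mul0n addn0.
  rewrite IH// itE; congr prod_jet; apply/funext => j.
  rewrite in_cons; case: eqP => [->|_] /=; last by rewrite mul0n addn0.
  by rewrite (negbTE iNs) mul0n !mul1n addn0.
rewrite /multi_partial H ?enum_uniq//; congr prod_jet; apply/funext => j.
by rewrite mem_enum mul1n.
Qed.

Lemma prod_jet_supp F a (lo hi : 'I_m -> R) v :
  (forall i s, s < lo i \/ hi i < s -> F i (a i) s = 0) ->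
  prod_jet F a v != 0 -> forall i, lo i <= v ord0 i <= hi i.
Proof.
move=> F0 vn0 i; apply: contraNT vn0.
rewrite negb_and -!ltNge => /orP H.
by rewrite /prod_jet (bigD1 i)//= F0 ?mul0r.
Qed.

(** The support lies in the compact box with sides [lo i, hi i]. *)
Lemma prod_jet_test F a (lo hi : 'I_m -> R) : (forall i, jet (F i)) ->
  (forall i s, s < lo i \/ hi i < s -> F i (a i) s = 0) ->
  (forall i, 0 < lo i) -> (forall i, hi i < 1) ->
  test_function (open_unit_cube R m) (prod_jet F a).
Proof.
move=> jF F0 lo0 hi1; split; first exact: prod_jet_smooth.
pose B : set 'rV[R]_m := [set v | forall i, `[lo i, hi i]%classic (v ord0 i)].
have cB : compact B.
  exact: (@rV_compact _ _ (fun i => `[lo i, hi i]%classic)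
    (fun i => @segment_compact R (lo i) (hi i))).
have clB : closed B by apply: compact_closed => //; exact: norm_hausdorff.
have sB : closure [set x | prod_jet F a x != 0] `<=` B.
  rewrite ((closure_id B).1 clB); apply: closure_subset => v /= vn0 i.
  by rewrite /= in_itv/=; exact: prod_jet_supp vn0 i.
split; first by apply: subclosed_compact cB sB; exact: closed_closure.
move=> v /sB Bv i; have := Bv i; rewrite /= in_itv/= => /andP[lv vh].
by rewrite (lt_le_trans (lo0 i) lv) (le_lt_trans vh (hi1 i)).
Qed.

End product_functions.

(** * Integral estimates *)

Section integral_bounds.
Context {d} {T : measurableType d} {R : realType}.
Context (mu : {measure set T -> \bar R}).
Implicit Types (D : set T) (f g : T -> R).

Lemma normr_Rintegral_le D f B : measurable D -> measurable_fun D f ->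
  (\int[mu]_(x in D) `|f x|%:E <= B%:E)%E -> `|Rintegral mu D f| <= B.
Proof.
move=> mD mf fB; rewrite /Rintegral.
have : (`|\int[mu]_(x in D) (f x)%:E| <= B%:E)%E.
  apply: le_trans fB; apply: (le_trans (le_abse_integral _ mD _)) => //.
  exact/measurable_EFinP.
case: (\int[mu]_(x in D) (f x)%:E)%E => //=.
Qed.

(** Hoelder's inequality for the restriction of g to D and the indicator function
    of D. *)
Lemma hoelder_set D g (p A b : R) : 1 < p -> measurable D -> measurable_fun D g ->
  0 <= A -> 0 <= b -> (mu D <= b%:E)%E ->
  (\int[mu]_(x in D) (`|g x| `^ p)%:E <= A%:E)%E ->
  (\int[mu]_(x in D) `|g x|%:E <= (A `^ p^-1 * b `^ (1 - p^-1))%:E)%E.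
Proof.
move=> p1 mD mg A0 b0 Db gA.
have p0 : 0 < p by rewrite (lt_trans _ p1).
have q0 : 0 < 1 - p^-1 by rewrite subr_gt0 invf_lt1.
pose q := (1 - p^-1)^-1.
have pq : p^-1 + q^-1 = 1 by rewrite /q invrK addrC subrK.
pose u := g \_ D; pose v : T -> R := \1_D.
have mu_ : measurable_fun setT u by exact/(measurable_restrictT _ _).1.
have mv : measurable_fun setT v by exact: measurable_indic.
have q0' : 0 < q by rewrite invr_gt0.
have := hoelder mu mu_ mv p0 q0' pq.
have -> : ('N[mu]_1[EFin \o (u \* v)%R] = \int[mu]_(x in D) `|g x|%:E)%E.
  rewrite Lnorm1 [RHS]integral_mkcond; apply: eq_integral => x _.
  rewrite /= /u /v indicE !patchE; case: ifPn => xD; last by rewrite mul0r normr0.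
  by rewrite mulr1.
move=> /le_trans; apply; rewrite EFinM; apply: lee_pmul => //; do ?exact: Lnorm_ge0.
  rewrite unlock -poweR_EFin; apply: gt0_ler_poweR.
  - by rewrite invr_ge0 ltW.
  - by rewrite in_itv/= leey integral_ge0// => x _; exact: poweR_ge0.
  - by rewrite in_itv/= leey lee_fin A0.
  - apply: le_trans gA; rewrite [leRHS]integral_mkcond le_eqVlt; apply/orP; left; apply/eqP.
    apply: eq_integral => x _; rewrite /u /= !patchE; case: ifPn => xD //=.
    by rewrite (_ : point = 0 :> R)// normr0 powR0 ?gt_eqF.
rewrite unlock -poweR_EFin {2}/q invrK; apply: gt0_ler_poweR.
- exact: ltW.
- by rewrite in_itv/= leey integral_ge0// => x _; exact: poweR_ge0.
- by rewrite in_itv/= leey lee_fin b0.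
- apply: le_trans Db; rewrite -[in leRHS](setIT D) -integral_indic//.
  rewrite le_eqVlt; apply/orP; left; apply/eqP; apply: eq_integral => x _.
  rewrite /v /= indicE; case: (x \in D) => /=; first by rewrite normr1 powR1.
  by rewrite normr0 powR0// gt_eqF.
Qed.

Lemma Rintegral_sum D (I : Type) (s : seq I) (h : I -> T -> R) : measurable D ->
  (forall i, mu.-integrable D (EFin \o h i)) ->
  Rintegral mu D (fun x => \sum_(i <- s) h i x) = \sum_(i <- s) Rintegral mu D (h i).
Proof.
move=> mD ih; elim: s => [|i s IH].
  rewrite big_nil /Rintegral (eq_integral (cst 0%E)) ?integral0// => x _.
  by rewrite big_nil.
rewrite big_cons -IH -RintegralD//.
  by apply: eq_Rintegral => x _; rewrite big_cons.
have -> : EFin \o (fun x => \sum_(j <- s) h j x) =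
    (fun x => \sum_(j <- s) (EFin \o h j) x)%E.
  by apply/funext => x; rewrite /= sumEFin.
exact: integrable_sum.
Qed.

End integral_bounds.

(** * Product kernels on shrinking cubes *)

Section shrinking_kernels.
Context {R : realType} {m : nat} (E : nat -> R -> R) (k : nat).
Context (c : 'I_m -> R) (r : R) (x : 'rV[R]_m).

(** The cubes with these corners and sides are the images of the cube with corner c
    and side r under the homotheties of centre x and ratio 2^-j.  They are nested
    and contain x, and for j = 0 the cube does not depend on x. *)
Definition side (j : nat) : R := r / 2 ^+ j.
Definition corner (j : nat) (i : 'I_m) : R :=
  x ord0 i - (x ord0 i - c i) / 2 ^+ j.
Definition subcube (j : nat) : set 'rV[R]_m :=
  box (fun i => `]corner j i, corner j i + side j[%classic).

Definition coord_kernel j i := kernel_jet E k (x ord0 i) (corner j i) (side j).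

(** Kernels of scale j.+1 in the first t coordinates and of scale j in the others:
    the product kernels of two consecutive scales are joined by m changes of a
    single factor. *)
Definition hybrid j t (v : 'rV[R]_m) := \prod_(i < m)
  (if (i < t)%N then coord_kernel j.+1 i k.+1 (v ord0 i)
   else coord_kernel j i k.+1 (v ord0 i)).

(** A (k+1)-fold primitive in the coordinate t of the difference of two consecutive
    hybrids: the factor t is the difference of the primitives of two kernels, and
    the other factors are the kernels themselves. *)
Definition primitive_jet j (t i : 'I_m) n s :=
  if (i < t)%N then coord_kernel j.+1 i (k.+1 + n)%N s
  else if i == t then coord_kernel j.+1 i n s - coord_kernel j i n s
  else coord_kernel j i (k.+1 + n)%N s.

Definition primitive j t := prod_jet (primitive_jet j t) (fun=> 0%N).

Definition pure_index (t : 'I_m) (i : 'I_m) : nat := if i == t then k.+1 else 0%N.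

Context (sE : step_jet E) (r0 : 0 < r).
Context (cx : forall i, c i <= x ord0 i <= c i + r).

Lemma side_gt0 j : 0 < side j.
Proof. by rewrite /side divr_gt0// exprn_gt0. Qed.

Lemma sideS j : side j.+1 = side j / 2.
Proof. by rewrite /side exprS invfM mulrA mulrAC. Qed.

Lemma corner0 i : corner 0 i = c i.
Proof. by rewrite /corner expr0 divr1 opprB addrC subrK. Qed.

Lemma corner_bounds j i : [/\ c i <= corner j i,
  corner j i + side j <= c i + r & corner j i <= x ord0 i <= corner j i + side j].
Proof.
have /andP[cx1 cx2] := cx i.
have t0 : 0 <= 1 - (2 ^+ j)^-1 :> R by rewrite subr_ge0 invf_le1 ?exprn_ege1 ?exprn_gt0 ?ler1n.
have t1 : 0 <= (2 ^+ j)^-1 :> R by rewrite invr_ge0 exprn_ge0.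
rewrite /corner /side; set t : R := (2 ^+ j)^-1 in t0 t1 *.
have h1 : 0 <= (x ord0 i - c i) * (1 - t) by rewrite mulr_ge0// subr_ge0.
have h2 : 0 <= (c i + r - x ord0 i) * (1 - t) by rewrite mulr_ge0// subr_ge0.
have h3 : 0 <= (x ord0 i - c i) * t by rewrite mulr_ge0// subr_ge0.
have h4 : 0 <= (c i + r - x ord0 i) * t by rewrite mulr_ge0// subr_ge0.
split; [lra|lra|apply/andP; split; lra].
Qed.

Lemma corner_nested j i :
  corner j i <= corner j.+1 i /\ corner j.+1 i + side j.+1 <= corner j i + side j.
Proof.
have /andP[cx1 cx2] := cx i.
have t1 : 0 <= (2 ^+ j)^-1 :> R by rewrite invr_ge0 exprn_ge0.
rewrite sideS /corner /side exprS invfM; set t : R := (2 ^+ j)^-1 in t1 *.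
have h3 : 0 <= (x ord0 i - c i) * t by rewrite mulr_ge0// subr_ge0.
have h4 : 0 <= (c i + r - x ord0 i) * t by rewrite mulr_ge0// subr_ge0.
split; lra.
Qed.

Lemma coord_kernel_jet j i : jet (coord_kernel j i).
Proof. by apply: kernel_jetP; case: sE. Qed.

Lemma coord_kernel_supp j i n s :
  s < corner j i + side j / 4 \/ corner j i + 3 / 4 * side j < s ->
  coord_kernel j i (k.+1 + n)%N s = 0.
Proof. by move=> H; apply: kernel_supp => //; exact: side_gt0. Qed.

Lemma primitive_jetP j t i : jet (primitive_jet j t i).
Proof.
rewrite /primitive_jet; case: (i < t)%N; first exact/jet_shift/coord_kernel_jet.
case: (i == t); first by apply: jetB; exact: coord_kernel_jet.
exact/jet_shift/coord_kernel_jet.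
Qed.

(** The margin side / 8 is a quarter of the side at the finer scale, where the
    finer cutoff is still constant. *)
Lemma primitive_jet_supp j t i n s :
  s < corner j i + side j / 8 \/ corner j i + side j - side j / 8 < s ->
  primitive_jet j t i n s = 0.
Proof.
have h0 := side_gt0 j; have h1 := side_gt0 j.+1.
have [n1 n2] := corner_nested j i; rewrite sideS in n1 n2 h1.
case=> H; rewrite /primitive_jet.
  case: ifP => _; first by apply: coord_kernel_supp; left; rewrite sideS; lra.
  case: ifP => _; last by apply: coord_kernel_supp; left; lra.
  by rewrite /coord_kernel !kernel_left ?subrr ?side_gt0// ?sideS; lra.
case: ifP => _; first by apply: coord_kernel_supp; right; rewrite sideS; lra.
case: ifP => _; last by apply: coord_kernel_supp; right; lra.
by rewrite /coord_kernel !kernel_right ?subrr ?side_gt0// ?sideS; lra.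
Qed.

(** The hybrids differ in the factor t only, and there by the difference of two
    kernels, which is a derivative of order k.+1. *)
Lemma hybridB j (t : 'I_m) v :
  hybrid j t.+1 v - hybrid j t v = multi_partial (pure_index t) (primitive j t) v.
Proof.
rewrite multi_partial_prod_jet; last by move=> i; exact: primitive_jetP.
rewrite /hybrid /prod_jet (bigD1 t)//= [X in _ - X](bigD1 t)//= [RHS](bigD1 t)//=.
rewrite ltnSn ltnn /primitive_jet ltnn eqxx /pure_index eqxx mulrBl.
(* For i != t, the tests i < t and i < t.+1 agree; b selects one of them. *)
have H : forall b : bool, \prod_(i < m | i != t)
   (if (i < t + b)%N then coord_kernel j.+1 i k.+1 (v ord0 i)
    else coord_kernel j i k.+1 (v ord0 i)) =
  \prod_(i < m | i != t)
   (if (i < t)%N then coord_kernel j.+1 i (k.+1 + (0 + (if i == t then k.+1 else 0)))%N (v ord0 i)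
    else if i == t then coord_kernel j.+1 i (0 + (if i == t then k.+1 else 0))%N (v ord0 i) -
     coord_kernel j i (0 + (if i == t then k.+1 else 0))%N (v ord0 i)
     else coord_kernel j i (k.+1 + (0 + (if i == t then k.+1 else 0)))%N (v ord0 i)).
  move=> b; apply: eq_bigr => i it; rewrite (negbTE it) !addn0.
  by congr (if _ then _ else _); case: b; move: it; rewrite -val_eqE /=; lia.
rewrite -{1}(H true) -(H false) addn1 addn0 add0n.
by congr (_ * _ - _ * _); apply: eq_bigr.
Qed.

Lemma hybrid_end j v : hybrid j m v = hybrid j.+1 0 v.
Proof. by apply: eq_bigr => i _; rewrite ltn_ord. Qed.

Lemma primitive_test j t : (forall i, 0 <= c i) -> (forall i, c i + r <= 1) ->
  test_function (open_unit_cube R m) (primitive j t).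
Proof.
move=> c0 c1; apply: (@prod_jet_test _ _ _ _ (fun i => corner j i + side j / 8)
  (fun i => corner j i + side j - side j / 8)).
- by move=> i; exact: primitive_jetP.
- by move=> i s; exact: primitive_jet_supp.
- move=> i; have [h _ _] := corner_bounds j i; have := side_gt0 j; have := c0 i; lra.
- move=> i; have [_ h _] := corner_bounds j i; have := side_gt0 j; have := c1 i; lra.
Qed.

Lemma primitive_supp j t v : primitive j t v != 0 -> subcube j v.
Proof.
move=> vn0 i; have := @prod_jet_supp _ _ _ _ (fun i => corner j i + side j / 8)
  (fun i => corner j i + side j - side j / 8) v _ vn0 i.
move=> /(_ (fun i s => @primitive_jet_supp j t i 0%N s)).
by rewrite /= in_itv/=; have := side_gt0 j; lra.
Qed.

Lemma hybrid_supp j t v : hybrid j t v != 0 -> subcube j v.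
Proof.
move=> vn0 i; apply: contra_neqP vn0; rewrite /= in_itv/= => /negP.
rewrite negb_and -!leNgt => H.
have h0 := side_gt0 j; have [n1 n2] := corner_nested j i; rewrite sideS in n2.
rewrite /hybrid (bigD1 i)//= -[k.+1]addn0.
case: ifP => _; rewrite coord_kernel_supp ?mul0r// ?sideS.
  by case/orP: H => H; [left|right]; lra.
by case/orP: H => H; [left|right]; lra.
Qed.

Lemma hybrid_continuous j t : continuous (hybrid j t).
Proof.
move=> v; apply: continuous_big; first exact: mul_continuous.
move=> i _ w; case: (i < t)%N.
  apply: (@continuous_comp _ _ _ (fun v : 'rV[R]_m => v ord0 i) (coord_kernel j.+1 i k.+1)).
    exact: coord_continuous.
  exact/jet_continuous/coord_kernel_jet.
apply: (@continuous_comp _ _ _ (fun v : 'rV[R]_m => v ord0 i) (coord_kernel j i k.+1)).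
  exact: coord_continuous.
exact/jet_continuous/coord_kernel_jet.
Qed.

Section bounds.
Context (C : R).
Context (C0 : 0 <= C).
Context (HK : forall u a h, 0 < h -> a <= u <= a + h ->
  forall s, `|kernel_jet E k u a h k.+1 s| <= C / h).
Context (HD : forall u a h a' h', 0 < h -> 0 < h' -> a <= a' ->
  a' + h' <= a + h -> a <= u <= a + h ->
  forall s, `|kernel_jet E k u a' h' 0%N s - kernel_jet E k u a h 0%N s| <= C * h ^+ k).

(** The factor 2 makes this bound common to the scales j and j.+1. *)
Lemma coord_kernel_bound j i s : `|coord_kernel j i k.+1 s| <= 2 * C / side j.
Proof.
have [_ _ xb] := corner_bounds j i.
apply: (le_trans (HK (side_gt0 j) xb s)).
by rewrite ler_pM2r ?invr_gt0 ?side_gt0//; move: C0; lra.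
Qed.

Lemma coord_kernelS_bound j i s : `|coord_kernel j.+1 i k.+1 s| <= 2 * C / side j.
Proof.
have [_ _ xb] := corner_bounds j.+1 i.
apply: (le_trans (HK (side_gt0 j.+1) xb s)).
by rewrite sideS invf_div mulrA (mulrC C).
Qed.

Lemma hybrid_bound j t v : `|hybrid j t v| <= (2 * C / side j) ^+ m.
Proof.
rewrite normr_prod -[X in _ ^+ X]card_ord -prodr_const; apply: ler_prod => i _.
rewrite normr_ge0/=; case: ifP => _; [exact: coord_kernelS_bound|exact: coord_kernel_bound].
Qed.

Lemma primitive_bound j t v :
  `|primitive j t v| <= (2 * C / side j) ^+ m * side j ^+ k.+1.
Proof.
have h0 := side_gt0 j.
rewrite normr_prod (bigD1 t)//= -[X in _ ^+ X]card_ord -prodr_const [in leRHS](bigD1 t)//=.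
rewrite mulrAC ler_pM// ?prodr_ge0//.
  rewrite /primitive_jet ltnn eqxx.
  have [_ _ xb] := corner_bounds j t; have [n1 n2] := corner_nested j t.
  apply: (le_trans (HD h0 (side_gt0 j.+1) n1 n2 xb _)).
  rewrite exprS mulrA divfK ?gt_eqF//.
  by rewrite ler_wpM2r ?exprn_ge0 ?(ltW h0)//; move: C0; lra.
apply: ler_prod => i it; rewrite normr_ge0/= /primitive_jet (negbTE it) addn0.
by case: ifP => _; [exact: coord_kernelS_bound|exact: coord_kernel_bound].
Qed.

End bounds.

Lemma lebesgue_measure_subcube j :
  lebesgue_measure_rV R m (subcube j) = (side j ^+ m)%:E.
Proof.
have L i : @lebesgue_measure R `]corner j i, corner j i + side j[%classic = (side j)%:E.
  rewrite lebesgue_measure_itv/= lte_fin ltrDl side_gt0//.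
  by rewrite -EFinB addrAC subrr add0r.
rewrite lebesgue_measure_box; last 2 first.
- by move=> i; exact: measurable_itv.
- by move=> i; rewrite L ltry.
by rewrite (eq_bigr (fun=> side j)) ?prodr_const ?card_ord// => i _; rewrite L.
Qed.

Lemma measurable_subcube j : measurable (subcube j).
Proof. by apply: measurable_box => i; exact: measurable_itv. Qed.

End shrinking_kernels.

(** * Sobolev functions on the unit cube *)

Section unit_cube.
Context {R : realType} {m : nat}.
Local Notation Lambda := (lebesgue_measure_rV R m).
Local Notation Omega := (open_unit_cube R m).

Definition open_cube (c : 'I_m -> R) (r : R) : set 'rV[R]_m :=
  box (fun i => `]c i, c i + r[%classic).

Lemma open_unit_cubeE : Omega = box (fun=> `]0, 1[%classic).
Proof. by apply/seteqP; split => v vO i; have := vO i; rewrite /= ?in_itv. Qed.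

Lemma measurable_open_unit_cube : measurable Omega.
Proof. by rewrite open_unit_cubeE; apply: measurable_box => i; exact: measurable_itv. Qed.

Lemma lebesgue_measure_open_unit_cube : Lambda Omega = 1%E.
Proof.
have L : @lebesgue_measure R `]0, 1[%classic = 1%E.
  by rewrite lebesgue_measure_itv/= lte_fin ltr01 -EFinB subr0.
rewrite open_unit_cubeE lebesgue_measure_box; last 2 first.
- by move=> i; exact: measurable_itv.
- by move=> i; rewrite L ltry.
by rewrite big1// => i _; rewrite L.
Qed.

Lemma measurable_open_cube c r : measurable (open_cube c r).
Proof. by apply: measurable_box => i; exact: measurable_itv. Qed.

Lemma open_cube_sub c r : (forall i, 0 <= c i) -> (forall i, c i + r <= 1) ->
  open_cube c r `<=` Omega.
Proof.
move=> c0 c1 v vQ i; have := vQ i; rewrite /= in_itv/= => /andP[v1 v2].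
by rewrite (le_lt_trans (c0 i) v1) (lt_le_trans v2 (c1 i)).
Qed.

Lemma open_unit_cube_closed : Omega `<=` closed_unit_cube R m.
Proof. by move=> v vO i; have /andP[/ltW -> /ltW ->] := vO i. Qed.

Lemma compact_closed_unit_cube : compact (closed_unit_cube R m).
Proof.
have -> : closed_unit_cube R m = [set v : 'rV[R]_m | forall i, `[0, 1]%classic (v ord0 i)].
  by apply/seteqP; split => v vO i; have := vO i; rewrite /= ?in_itv.
exact: (@rV_compact _ _ (fun _ : 'I_m => `[(0 : R), (1 : R)]%classic)
  (fun _ => @segment_compact R 0 1)).
Qed.

Lemma bounded_on_closed_unit_cube (f : 'rV[R]_m -> R) :
  {within closed_unit_cube R m, continuous f} ->
  exists M, forall v, closed_unit_cube R m v -> `|f v| <= M.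
Proof.
move=> cf; have [|||v _ vM] := @EVT_max_rV R m (fun v => `|f v|) (closed_unit_cube R m).
- by exists 0 => i; rewrite mxE lexx ler01.
- exact: compact_closed_unit_cube.
- by move=> w; apply: continuous_comp; [exact: cf|exact: norm_continuous].
by exists `|f v| => w wC; apply: vM; rewrite inE.
Qed.

Lemma integrable_mul_continuous (f psi : 'rV[R]_m -> R) :
  {within closed_unit_cube R m, continuous f} -> measurable_fun Omega f ->
  continuous psi -> Lambda.-integrable Omega (EFin \o (fun v => f v * psi v)).
Proof.
move=> cf mf cpsi; have [M fM] := bounded_on_closed_unit_cube cf.
have [|N psiN] := @bounded_on_closed_unit_cube psi; first exact: continuous_subspaceT.
apply: measurable_bounded_integrable.
- exact: measurable_open_unit_cube.
- rewrite [X in (X < _)%E](_ : _ = 1%E) ?ltry//.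
  exact: lebesgue_measure_open_unit_cube.
- apply: measurable_funM => //; apply: measurable_funTS.
  exact: continuous_measurable_rV.
exists (M * N); split; first exact: num_real.
move=> K MK v vO /=; apply: (le_trans _ (ltW MK)); rewrite normrM.
by apply: ler_pM => //; [apply: fM|apply: psiN]; exact: open_unit_cube_closed.
Qed.

End unit_cube.

Section gradient.
Context {R : realType} {m : nat}.
Local Notation Lambda := (lebesgue_measure_rV R m).
Local Notation Omega := (open_unit_cube R m).
Context (l : nat) (p : R) (f : 'rV[R]_m -> R).
Context (fW : sobolev Omega l p f).

Lemma weak_derivativeP (a : 'I_m -> nat) : (mi_order a <= l)%N ->
  is_weak_derivative Omega a f (weak_derivative Omega a f).
Proof.
case: fW => _ /[apply] -[g fg _].
exact: (@xgetPex _ (cst 0) [set g | is_weak_derivative Omega a f g] (ex_intro _ g fg)).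
Qed.

Lemma measurable_sobolev : measurable_fun Omega f.
Proof.
case: fW => + _; rewrite /Lp_on => /andP[/[!inE] mf _].
have mf' : measurable_fun setT (f \_ Omega) := mf.
exact: (measurable_restrictT f measurable_open_unit_cube).2 mf'.
Qed.

Lemma measurable_weak_derivative a : (mi_order a <= l)%N ->
  measurable_fun Omega (weak_derivative Omega a f).
Proof. by move=> /weak_derivativeP[[]]. Qed.

Lemma measurable_gradient_norm : measurable_fun Omega (gradient_norm Omega l f).
Proof.
rewrite /gradient_norm.
have ms : measurable_fun [set: R] (@Num.sqrt R).
  by apply: continuous_measurable_fun; exact: sqrt_continuous.
apply: (measurableT_comp ms).
under eq_fun do rewrite big_mkcond/=.
apply: measurable_sum => a.
case al : (mi_order (fun i => a i : nat) == l); last exact: measurable_cst.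
move/eqP in al.
by apply: measurable_funX; apply: measurable_weak_derivative; rewrite al.
Qed.

Lemma weak_derivative_le_gradient (a : 'I_m -> nat) v : mi_order a = l ->
  `|weak_derivative Omega a f v| <= gradient_norm Omega l f v.
Proof.
move=> al; have ai i : (a i < l.+1)%N.
  by rewrite ltnS -al /mi_order (bigD1 i)//= leq_addr.
pose b : {ffun 'I_m -> 'I_l.+1} := [ffun i => Ordinal (ai i)].
have ba : (fun i => b i : nat) = a by apply/funext => i; rewrite ffunE.
rewrite /gradient_norm -sqrtr_sqr ler_wsqrtr// (bigD1 b)/=; last by rewrite ba al.
by rewrite ba lerDl sumr_ge0// => *; rewrite sqr_ge0.
Qed.

Lemma gradient_norm_ge0 v : 0 <= gradient_norm Omega l f v.
Proof. exact: sqrtr_ge0. Qed.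

End gradient.

Lemma mi_order_pure_index m k (t : 'I_m) : mi_order (pure_index k t) = k.+1.
Proof.
rewrite /mi_order (bigD1 t)//= /pure_index eqxx big1 ?addn0// => i it.
by rewrite (negbTE it).
Qed.

(** * Local polynomial approximation *)

Lemma powR2N_lt1 {R : realType} (d : R) : 0 < d -> 2 `^ (- d) < 1.
Proof.
move=> d0; have l0 : 0 < ln 2 :> R by apply: ln_gt0; rewrite ltr1n.
rewrite /powR (_ : (2 == 0 :> R) = false); last by rewrite pnatr_eq0.
by rewrite -[ltRHS]expR0 ltr_expR mulNr oppr_lt0 mulr_gt0.
Qed.

Lemma powR_half_pow {R : realType} (r d : R) j : 0 <= r ->
  (r / 2 ^+ j) `^ d = r `^ d * (2 `^ (- d)) ^+ j.
Proof.
move=> r0; elim: j => [|j IH]; first by rewrite !expr0 divr1 mulr1.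
have r2 : 0 <= r / 2 ^+ j by rewrite divr_ge0// exprn_ge0.
rewrite exprSr invfM mulrA powRM ?invr_ge0// IH exprSr mulrA; congr (_ * _).
by rewrite -powR_inv1// -powRrM mulN1r.
Qed.

Section local_approximation.
Context {R : realType} {m : nat}.
Local Notation Lambda := (lebesgue_measure_rV R m).
Local Notation Omega := (open_unit_cube R m).
Context (E : nat -> R -> R) (k : nat) (p : R) (f : 'rV[R]_m -> R).
Context (sE : step_jet E) (p1 : 1 < p).
Context (fW : sobolev Omega k.+1 p f).
Context (cf : {within closed_unit_cube R m, continuous f}).
Context (c : 'I_m -> R) (r : R) (r0 : 0 < r).
Context (c0 : forall i, 0 <= c i) (c1 : forall i, c i + r <= 1).
Context (A : R) (A0 : 0 <= A).
Context (fA : (\int[Lambda]_(v in open_cube c r)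
   (gradient_norm Omega k.+1 f v `^ p)%:E <= A%:E)%E).

Let delta := k.+1%:R - m%:R / p.

Let mOmega : measurable Omega := measurable_open_unit_cube.
Let mf := measurable_sobolev fW.

(** Only the pure derivatives of order k.+1 are used; they are dominated by the
    gradient. *)
Lemma weak_derivative_energy (t : 'I_m) D : measurable D -> D `<=` open_cube c r ->
  (\int[Lambda]_(v in D)
     (`|weak_derivative Omega (pure_index k t) f v| `^ p)%:E <= A%:E)%E.
Proof.
move=> mD DQ; apply: le_trans fA.
have QO := open_cube_sub c0 c1.
have p0 : 0 <= p by rewrite ltW// (lt_trans _ p1).
have mw : measurable_fun (open_cube c r) (weak_derivative Omega (pure_index k t) f).
  apply: measurable_funS (measurable_weak_derivative fW _) => //.
  by rewrite mi_order_pure_index.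
have mg : measurable_fun (open_cube c r) (gradient_norm Omega k.+1 f).
  exact: measurable_funS (measurable_gradient_norm fW).
have mwp : measurable_fun (open_cube c r)
    (fun v => (`|weak_derivative Omega (pure_index k t) f v| `^ p)%:E).
  apply/measurable_EFinP; apply: (measurableT_comp (measurable_powR p)).
  exact: measurableT_comp.
apply: (@le_trans _ _ (\int[Lambda]_(v in open_cube c r)
     (`|weak_derivative Omega (pure_index k t) f v| `^ p)%:E)%E).
  by apply: ge0_subset_integral => //; exact: measurable_open_cube.
apply: ge0_le_integral => //.
- exact: measurable_open_cube.
- by apply/measurable_EFinP; apply: (measurableT_comp (measurable_powR p)).
- move=> v _; rewrite lee_fin ge0_ler_powR ?nnegrE ?gradient_norm_ge0//.
  by apply: weak_derivative_le_gradient; rewrite mi_order_pure_index.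
Qed.

Section point.
Context (x : 'rV[R]_m) (cx : forall i, c i <= x ord0 i <= c i + r).
Context (C : R) (C0 : 0 <= C).
Context (HK : forall u a h, 0 < h -> a <= u <= a + h ->
  forall s, `|kernel_jet E k u a h k.+1 s| <= C / h).
Context (HD : forall u a h a' h', 0 < h -> 0 < h' -> a <= a' ->
  a' + h' <= a + h -> a <= u <= a + h ->
  forall s, `|kernel_jet E k u a' h' 0%N s - kernel_jet E k u a h 0%N s| <= C * h ^+ k).

Lemma subcube_sub j : subcube c r x j `<=` open_cube c r.
Proof.
move=> v vS i; have := vS i; have [h1 h2 _] := corner_bounds cx j i.
by rewrite /= !in_itv/= => /andP[v1 v2]; rewrite (le_lt_trans h1 v1) (lt_le_trans v2 h2).
Qed.

(** The change of kernel is a derivative of a test function phi, so the integral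
    becomes that of phi times a weak derivative of f.  With h the side, phi has
    size h^(k+1-m) and is supported in a cube of measure h^m, and Hoelder's
    inequality gives the exponent k + 1 - m + m (1 - 1/p) = k + 1 - m/p. *)
Lemma hybrid_step_bound j (t : 'I_m) :
  `|Rintegral Lambda Omega (fun v => f v * hybrid E k c r x j t.+1 v)
    - Rintegral Lambda Omega (fun v => f v * hybrid E k c r x j t v)|
  <= (2 * C) ^+ m * A `^ p^-1 * side r j `^ delta.
Proof.
have h0 := side_gt0 r0 j; set h := side r j in h0 *.
have mS := measurable_subcube c r x j.
rewrite -RintegralB//; last 2 first.
- exact/integrable_mul_continuous/hybrid_continuous.
- exact/integrable_mul_continuous/hybrid_continuous.
set g := weak_derivative Omega (pure_index k t) f.
set phi := primitive E k c r x j t.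
have -> : Rintegral Lambda Omega (fun v => f v * hybrid E k c r x j t.+1 v -
    f v * hybrid E k c r x j t v) =
    Rintegral Lambda Omega (fun v => f v * multi_partial (pure_index k t) phi v).
  by apply: eq_Rintegral => v _; rewrite -mulrBr hybridB.
have [_ ->] : is_weak_derivative Omega (pure_index k t) f g.
  by apply: weak_derivativeP fW _ _; rewrite mi_order_pure_index.
2: exact: primitive_test.
rewrite normrM normrX normrN1 expr1n mul1r.
have mg : measurable_fun Omega g.
  by apply: measurable_weak_derivative fW _ _; rewrite mi_order_pure_index.
have mphi : measurable_fun [set: 'rV[R]_m] phi.
  apply: continuous_measurable_rV; apply: prod_jet_continuous => i.
  exact: primitive_jetP.
have SO : subcube c r x j `<=` Omega.
  by apply: subset_trans (open_cube_sub c0 c1); exact: subcube_sub.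
apply: normr_Rintegral_le => //.
  by apply: measurable_funM => //; exact: measurable_funTS.
have -> : (\int[Lambda]_(v in Omega) `|g v * phi v|%:E =
    \int[Lambda]_(v in subcube c r x j) `|g v * phi v|%:E)%E.
  rewrite [LHS]integral_mkcond [RHS]integral_mkcond; apply: eq_integral => v _.
  rewrite !patchE; case: ifPn => vO; case: ifPn => vS //.
    have -> : phi v = 0.
      apply/eqP; apply: contraNT vS => /primitive_supp h1.
      by rewrite inE; exact: h1.
    by rewrite mulr0 normr0.
  by move: vO; rewrite inE in vS; rewrite mem_set//; exact: SO.
pose M := (2 * C / h) ^+ m * h ^+ k.+1.
have M0 : 0 <= M.
  have h0' := ltW h0.
  by apply: mulr_ge0; apply: exprn_ge0 => //; apply: divr_ge0 => //; apply: mulr_ge0.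
have mgS : measurable_fun (subcube c r x j) g by exact: measurable_funS mg.
apply: (@le_trans _ _ (\int[Lambda]_(v in subcube c r x j) (M%:E * `|g v|%:E))%E).
  apply: ge0_le_integral => //.
  - apply/measurable_EFinP; apply: measurableT_comp => //.
    by apply: measurable_funM => //; exact: measurable_funTS.
  - by apply/measurable_EFinP; apply: measurable_funM => //; exact: measurableT_comp.
  - move=> v _; rewrite -EFinM lee_fin normrM mulrC ler_wpM2r//.
    exact: primitive_bound.
rewrite ge0_integralZl//; last first.
  by apply/measurable_EFinP; exact: measurableT_comp.
have LS : (lebesgue_measure_rV R m (subcube c r x j) <= (h ^+ m)%:E)%E.
  by rewrite lebesgue_measure_subcube.
have := @hoelder_set _ _ _ Lambda _ g p A (h ^+ m) p1 mS mgS A0 (exprn_ge0 _ (ltW h0)).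
move=> /(_ LS).
have enS := weak_derivative_energy t mS (@subcube_sub j).
move=> /(_ enS) H; apply: (le_trans (lee_wpmul2l _ H)); first by rewrite lee_fin.
rewrite -EFinM lee_fin le_eqVlt; apply/orP; left; apply/eqP.
rewrite /M expr_div_n -!mulrA; congr (_ * _).
rewrite mulrCA mulrA mulrC -!mulrA; congr (_ * _).
have hn0 : h != 0 by rewrite gt_eqF.
rewrite -!(powR_mulrn _ (ltW h0)) -powRN -powRrM -!powRD ?hn0 ?implybT//.
congr (_ `^ _); rewrite /delta; field.
by rewrite gt_eqF// (lt_trans _ p1).
Qed.

Let T j := Rintegral Lambda Omega (fun v => f v * hybrid E k c r x j 0 v).

Lemma telescope_bound j :
  `|T j.+1 - T j| <= m%:R * ((2 * C) ^+ m * A `^ p^-1 * side r j `^ delta).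
Proof.
set B := (X in _ <= _ * X).
pose I t := Rintegral Lambda Omega (fun v => f v * hybrid E k c r x j t v).
suff H t : (t <= m)%N -> `|I t - I 0%N| <= t%:R * B.
  have -> : T j.+1 = I m by apply: eq_Rintegral => v _; rewrite hybrid_end.
  exact: H.
elim: t => [_|t IH tm]; first by rewrite subrr normr0 mul0r.
rewrite -(subrK (I t) (I t.+1)) -addrA (le_trans (ler_normD _ _))//.
rewrite -natr1 mulrDl mul1r [leRHS]addrC; apply: lerD; last exact: IH (ltnW tm).
exact: (hybrid_step_bound j (Ordinal tm)).
Qed.

Lemma integrable_coord_kernel j i :
  (@lebesgue_measure R).-integrable setT
    (EFin \o coord_kernel E k c r x j i k.+1) /\
  Rintegral (@lebesgue_measure R) setT (coord_kernel E k c r x j i k.+1) = 1.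
Proof.
have h0 := side_gt0 r0 j; set a := corner c x j i; set h := side r j in h0.
set K := coord_kernel E k c r x j i k.+1.
have jK : continuous K by apply/jet_continuous/coord_kernel_jet.
have KE : (EFin \o K) = (EFin \o K) \_ `[a, a + h]%classic.
  apply/funext => s; rewrite patchE; case: ifPn => //.
  rewrite notin_setE /= in_itv/= => /negP; rewrite negb_and -!ltNge => H.
  rewrite /K -[k.+1]addn0 coord_kernel_supp//.
  by case/orP: H => H; [left|right]; rewrite -/a -/h; lra.
have iK : (@lebesgue_measure R).-integrable `[a, a + h] (EFin \o K).
  apply: continuous_compact_integrable; first exact: segment_compact.
  exact: continuous_subspaceT.
split; first by rewrite KE; apply: (integrable_mkcond _ _).1 iK; exact: measurable_itv.
rewrite /Rintegral -[RHS]/(fine 1%E); congr fine.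
have <- := kernel_integral k (x ord0 i) a sE h0; rewrite [RHS]integral_mkcond.
by rewrite -[in RHS]KE.
Qed.

(** The kernel has integral 1 over the whole space as a product, and its support
    lies in the unit cube. *)
Lemma Rintegral_hybrid j : Rintegral Lambda Omega (hybrid E k c r x j 0) = 1.
Proof.
have [_] := integral_prod_coord (fun i => (integrable_coord_kernel j i).1).
under eq_bigr do rewrite (integrable_coord_kernel j _).2.
rewrite big1// => <-; rewrite /Rintegral [in LHS]integral_mkcond; congr fine.
apply: eq_integral => v _; rewrite patchE; case: ifPn => // vO.
have H : hybrid E k c r x j 0 v = 0.
  apply/eqP; apply: contraNT vO => /hybrid_supp h; rewrite inE.
  by apply: (open_cube_sub c0 c1); apply: (@subcube_sub j); exact: h.
by rewrite -[X in (X)%:E]/(hybrid E k c r x j 0 v) H.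
Qed.

(** The kernels are an approximate identity at x: their supports shrink to x, and
    their L^1 norms are at most (2 C)^m.  Only continuity of f on the closed cube
    is available, and x may lie on its boundary. *)
Lemma cvg_hybrid e : 0 < e -> exists n, `|T n - f x| <= e * (2 * C) ^+ m.
Proof.
move=> e0.
have xC : closed_unit_cube R m x.
  by move=> i; have /andP[x1 x2] := cx i; have := c0 i; have := c1 i; lra.
have /subspace_continuousP /(_ x xC) /cvgrPdist_le /(_ e e0) := cf.
rewrite near_withinE => /nbhs_ballP[d /= d0 dP].
pose n := (Num.truncn (r / d)).+1; exists n.
have nd : side r n < d.
  rewrite /side ltr_pdivrMr ?exprn_gt0// mulrC -ltr_pdivrMr//.
  apply: (lt_trans (truncnS_gt _)); rewrite -natrX ltr_nat.
  exact: ltn_expl.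
have h0 := side_gt0 r0 n; set h := side r n in h0 nd *.
have hC : continuous (hybrid E k c r x n 0) by exact: hybrid_continuous.
have -> : T n - f x = Rintegral Lambda Omega
    (fun v => (f v - f x) * hybrid E k c r x n 0 v).
  have i1 : Lambda.-integrable Omega (EFin \o (fun v => f x * hybrid E k c r x n 0 v)).
    apply: (integrable_mul_continuous (f := fun=> f x)) => //.
    exact: continuous_subspaceT (@cst_continuous _ _ _).
  have -> : f x = Rintegral Lambda Omega (fun v => f x * hybrid E k c r x n 0 v).
    rewrite RintegralZl// ?Rintegral_hybrid ?mulr1//.
    have := integrable_mul_continuous (f := fun=> 1)
      (continuous_subspaceT (@cst_continuous _ _ _)) (@measurable_cst _ _ _ _ _ _) hC.
    by under eq_fun do rewrite mul1r.
  rewrite /T -RintegralB//; last exact: integrable_mul_continuous.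
  apply: eq_Rintegral => v _; rewrite -mulrBl; congr ((_ - _) * _).
  rewrite RintegralZl// ?Rintegral_hybrid ?mulr1//.
  have := integrable_mul_continuous (f := fun=> 1)
      (continuous_subspaceT (@cst_continuous _ _ _)) (@measurable_cst _ _ _ _ _ _) hC.
  by under eq_fun do rewrite mul1r.
apply: normr_Rintegral_le => //.
  apply: measurable_funM; first exact: measurable_funB.
  by apply: measurable_funTS; exact: continuous_measurable_rV.
pose M := e * (2 * C / h) ^+ m.
have M0 : 0 <= M.
  by apply: mulr_ge0; [exact: ltW|apply: exprn_ge0; rewrite divr_ge0 ?mulr_ge0// ltW].
have SO : subcube c r x n `<=` Omega.
  by apply: subset_trans (open_cube_sub c0 c1); exact: subcube_sub.
have mS := measurable_subcube c r x n.
have -> : (\int[Lambda]_(v in Omega) `|(f v - f x) * hybrid E k c r x n 0 v|%:E =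
    \int[Lambda]_(v in subcube c r x n) `|(f v - f x) * hybrid E k c r x n 0 v|%:E)%E.
  rewrite [LHS]integral_mkcond [RHS]integral_mkcond; apply: eq_integral => v _.
  rewrite !patchE; case: ifPn => vO; case: ifPn => vS //.
    have -> : hybrid E k c r x n 0 v = 0.
      apply/eqP; apply: contraNT vS => /hybrid_supp h1.
      by rewrite inE; exact: h1.
    by rewrite mulr0 normr0.
  by move: vO; rewrite inE in vS; rewrite mem_set//; exact: SO.
apply: (@le_trans _ _ (\int[Lambda]_(v in subcube c r x n) (cst M%:E v))%E).
  apply: ge0_le_integral => //.
  - apply/measurable_EFinP; apply: measurableT_comp => //.
    apply: measurable_funM; first by apply: measurable_funB => //; exact: measurable_funS mf.
    by apply: measurable_funTS; exact: continuous_measurable_rV.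
  - move=> v vS; rewrite /= lee_fin normrM ler_pM//; last exact: hybrid_bound.
    rewrite distrC; apply: dP; last exact/open_unit_cube_closed/SO.
    split => // i j; rewrite [i]ord1 -ball_normE/= (le_lt_trans _ nd)//.
    have [_ _ xb] := corner_bounds cx n j; have := vS j; rewrite /= in_itv/=.
    by rewrite ler_norml -/h in xb *; lra.
rewrite integral_cst//.
have LS : lebesgue_measure_rV R m (subcube c r x n) = (h ^+ m)%:E.
  by rewrite lebesgue_measure_subcube.
rewrite [X in (_ * X)%E](_ : _ = (h ^+ m)%:E)//.
rewrite -EFinM lee_fin /M expr_div_n -!mulrA mulVf ?mulr1//.
by rewrite expf_neq0// gt_eqF.
Qed.

Context (delta0 : 0 < delta).

(** Sum of the geometric series of ratio 2^(-delta) given by [telescope_bound],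
    then passage to the limit by [cvg_hybrid]. *)
Lemma kernel_average_bound : `|f x - T 0%N| <=
  m%:R * (2 * C) ^+ m / (1 - 2 `^ (- delta)) * (r `^ delta * A `^ p^-1).
Proof.
set q := 2 `^ (- delta); set B := (2 * C) ^+ m * A `^ p^-1.
have B0 : 0 <= B by rewrite mulr_ge0 ?exprn_ge0 ?mulr_ge0 ?powR_ge0.
have q1 : q < 1.
  exact: powR2N_lt1.
have q0 : 0 <= q by exact: powR_ge0.
have sE' j : side r j `^ delta = r `^ delta * q ^+ j.
  by rewrite /side powR_half_pow// ltW.
have H n : `|T n - T 0%N| <= m%:R * B * r `^ delta * \sum_(j < n) q ^+ j.
  elim: n => [|n IH]; first by rewrite subrr normr0 big_ord0 mulr0.
  rewrite -(subrK (T n) (T n.+1)) -addrA (le_trans (ler_normD _ _))//.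
  rewrite big_ord_recr/= mulrDr [leRHS]addrC; apply: lerD IH.
  by rewrite (le_trans (telescope_bound n))// sE' /B !mulrA.
have G n : \sum_(j < n) q ^+ j <= (1 - q)^-1.
  have := subrX1 q n => /(congr1 -%R); rewrite opprB -mulNr opprB => E1.
  rewrite -[leRHS]mul1r ler_pdivlMr ?subr_gt0// mulrC -E1.
  by rewrite lerBlDr lerDl exprn_ge0.
apply/ler_addgt0Pr => e e0.
have [n nP] := @cvg_hybrid (e / ((2 * C) ^+ m + 1)) (divr_gt0 e0 (ltr_wpDl (exprn_ge0 _ (mulr_ge0 (ler0n _ _) C0)) ltr01)).
rewrite -(subrK (T n) (f x)) -addrA (le_trans (ler_normD _ _))// [leRHS]addrC.
apply: lerD.
  rewrite distrC (le_trans nP)// mulrAC ler_pdivrMr ?ltr_wpDl ?exprn_ge0 ?mulr_ge0//.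
  by rewrite ler_wpM2l ?(ltW e0)// lerDl.
apply: (le_trans (H n)).
have -> : m%:R * (2 * C) ^+ m / (1 - q) * (r `^ delta * A `^ p^-1) =
    m%:R * B * r `^ delta * (1 - q)^-1 by rewrite /B; ring.
apply: ler_wpM2l (G n); apply: mulr_ge0; last exact: powR_ge0.
exact: mulr_ge0.
Qed.

End point.

End local_approximation.

Definition monomial {R : realType} {m : nat} (l : nat) (al : {ffun 'I_m -> 'I_l})
  (x : 'rV[R]_m) : R := \prod_i x ord0 i ^+ al i.

(** The polynomial is the average of f against the product kernel of scale 0: the
    cube of that scale does not depend on x, and the kernel depends on x
    polynomially by [kernel_coefE]. *)
Lemma local_approximation (R : realType) (m k : nat) (p : R) :
  1 < p -> 0 < k.+1%:R - m%:R / p -> exists2 C : R, 0 <= C &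
  forall f : 'rV[R]_m -> R, sobolev (open_unit_cube R m) k.+1 p f ->
  {within closed_unit_cube R m, continuous f} ->
  forall (c : 'I_m -> R) (r : R), 0 < r ->
  (forall i, 0 <= c i) -> (forall i, c i + r <= 1) ->
  forall A : R, 0 <= A ->
  (\int[lebesgue_measure_rV R m]_(v in open_cube c r)
     (gradient_norm (open_unit_cube R m) k.+1 f v `^ p)%:E <= A%:E)%E ->
  exists coef : {ffun 'I_m -> 'I_k.+1} -> R, forall x : 'rV[R]_m,
    (forall i, c i <= x ord0 i <= c i + r) ->
    `|f x - \sum_al coef al * monomial al x| <=
    C * (r `^ (k.+1%:R - m%:R / p) * A `^ p^-1).
Proof.
move=> p1 d0.
have [E sE] := @smooth_step R.
have [C1 C10 HK] := kernel_bound k sE; have [C2 C20 HD] := kernel_diff_bound k sE.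
pose C := C1 + C2; have C0 : 0 <= C by rewrite addr_ge0.
exists (m%:R * (2 * C) ^+ m / (1 - 2 `^ (- (k.+1%:R - m%:R / p)))).
  rewrite divr_ge0 ?mulr_ge0 ?exprn_ge0 ?mulr_ge0// subr_ge0.
  exact/ltW/powR2N_lt1.
move=> f fW cf c r r0 c0 c1 A A0 fA.
pose coef (al : {ffun 'I_m -> 'I_k.+1}) :=
  Rintegral (lebesgue_measure_rV R m) (open_unit_cube R m)
    (fun v => f v * \prod_i kernel_coef E k (c i) r (al i) (v ord0 i)).
exists coef => x cx.
have HK' u a h : 0 < h -> a <= u <= a + h ->
    forall s, `|kernel_jet E k u a h k.+1 s| <= C / h.
  move=> h0 uah s; rewrite (le_trans (HK _ _ _ h0 uah s))//.
  by rewrite ler_pM2r ?invr_gt0// lerDl.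
have HD' u a h a' h' : 0 < h -> 0 < h' -> a <= a' ->
    a' + h' <= a + h -> a <= u <= a + h -> forall s,
    `|kernel_jet E k u a' h' 0%N s - kernel_jet E k u a h 0%N s| <= C * h ^+ k.
  move=> h0 h'0 aa ah uah s; rewrite (le_trans (HD _ _ _ _ _ h0 h'0 aa ah uah s))//.
  by rewrite ler_wpM2r ?exprn_ge0 ?(ltW h0)// lerDr.
have := kernel_average_bound sE p1 fW cf r0 c0 c1 A0 fA cx C0 HK' HD' d0.
congr (`|_ - _| <= _).
have mf := measurable_sobolev fW.
have cK al : continuous (fun v : 'rV[R]_m => \prod_i kernel_coef E k (c i) r (al i) (v ord0 i)).
  move=> v; apply: continuous_big; first exact: mul_continuous.
  move=> i _ w; apply: (@continuous_comp _ _ _ (fun v : 'rV[R]_m => v ord0 i)).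
    exact: coord_continuous.
  by apply: kernel_coef_continuous; case: sE.
rewrite (eq_bigr (fun al => Rintegral (lebesgue_measure_rV R m) (open_unit_cube R m)
   (fun v => monomial al x * (f v * \prod_i kernel_coef E k (c i) r (al i) (v ord0 i))))); last first.
  move=> al _; rewrite RintegralZl 1?mulrC//; first exact: measurable_open_unit_cube.
  exact: integrable_mul_continuous.
rewrite -Rintegral_sum; last 2 first.
- exact: measurable_open_unit_cube.
- move=> al; rewrite (_ : _ \o _ = EFin \o (fun v => f v *
    (monomial al x * \prod_i kernel_coef E k (c i) r (al i) (v ord0 i)))).
    apply: integrable_mul_continuous => // v.
    by apply: (@cvgM _ _ (nbhs v) _ (fun=> monomial al x)); [exact: cvg_cst|exact: cK].
  by apply/funext => v /=; rewrite mulrCA.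
apply: eq_Rintegral => v _; rewrite /hybrid.
rewrite (eq_bigr (fun i => \sum_(b < k.+1) x ord0 i ^+ b * kernel_coef E k (c i) r b (v ord0 i))).
  rewrite bigA_distr_bigA mulr_sumr; apply: eq_bigr => al _.
  by rewrite big_split/= mulrCA.
by move=> i _; rewrite /= -kernel_coefE /coord_kernel corner0 /side expr0 divr1.
Qed.

(** * Dyadic cells *)

Section dyadic_cells.
Context {R : realType} {m : nat}.
Implicit Types (x : 'rV[R]_m) (l : 'I_m -> nat).

(** The dyadic cubes that meet the unit cube have natural indices, which makes the
    parent of a cell a halving of indices. *)
Definition cell (n : nat) l : set 'rV[R]_m := dyadic_cube n (fun i => (l i)%:Z).

Lemma cellP n l x : cell n l x <->
  forall i, (l i)%:R < 2 ^+ n * x ord0 i <= (l i).+1%:R.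
Proof.
have E i : (l i)%:R / 2 ^+ n < x ord0 i <= ((l i)%:Z + 1)%:~R / 2 ^+ n =
    ((l i)%:R < 2 ^+ n * x ord0 i <= (l i).+1%:R).
  rewrite ltr_pdivrMr ?exprn_gt0// ler_pdivlMr ?exprn_gt0// ![x _ _ * _]mulrC.
  by rewrite intrD -[(l i).+1%:R]natr1.
by split => H i; have := H i; rewrite E.
Qed.

Lemma cell_exists n x : half_open_unit_cube R m x -> exists l, cell n l x.
Proof.
move=> xQ.
have ex i : exists a : nat, a%:R < 2 ^+ n * x ord0 i <= a.+1%:R.
  have /andP[x0 x1] := xQ i; set y := 2 ^+ n * x ord0 i.
  have y0 : 0 < y by rewrite mulr_gt0// exprn_gt0.
  have : exists a, y <= a.+1%:R by exists (Num.truncn y); exact/ltW/truncnS_gt.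
  move=> /ex_minnP[a ya amin]; exists a; rewrite ya andbT.
  case: a ya amin => [//|a] ya amin; rewrite ltNge; apply/negP => /amin.
  by rewrite ltnn.
by have [l lP] := choice ex; exists l; exact/cellP.
Qed.

Lemma cell_uniq n l l' x : cell n l x -> cell n l' x -> l = l'.
Proof.
move=> /cellP lx /cellP l'x; apply/funext => i.
have /andP[a1 a2] := lx i; have /andP[b1 b2] := l'x i.
have := lt_le_trans a1 b2; have := lt_le_trans b1 a2.
by rewrite !ltr_nat; lia.
Qed.

Lemma cell_half n l : cell n.+1 l `<=` cell n (fun i => (l i)./2).
Proof.
move=> x /cellP lx; apply/cellP => i; have := lx i.
rewrite exprS -mulrA; set y := 2 ^+ n * _.
have := odd_double_half (l i); set h := (l i)./2 => lE.
have hl : h.*2%:R <= (l i)%:R :> R by rewrite ler_nat; lia.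
have lh : (l i).+1%:R <= (h.+1).*2%:R :> R by rewrite ler_nat; case: (odd _) lE => /=; lia.
move: hl lh; rewrite -!muln2 !natrM => hl lh /andP[a b].
by apply/andP; split; lra.
Qed.

Lemma cell_lt n l x i : half_open_unit_cube R m x -> cell n l x -> (l i < 2 ^ n)%N.
Proof.
move=> xQ /cellP lx; have /andP[x0 x1] := xQ i; have /andP[a _] := lx i.
rewrite -(ltr_nat R) (lt_le_trans a)// natrX -[leRHS]mulr1.
by rewrite ler_wpM2l// exprn_ge0.
Qed.

Lemma cell_sub a b l l' x : (a <= b)%N -> cell a l x -> cell b l' x ->
  cell b l' `<=` cell a l.
Proof.
move=> ab; elim: b ab l' => [|b IH] ab l' lx l'x.
  have a0 : a = 0%N by lia.
  by rewrite a0 in lx *; rewrite (cell_uniq lx l'x).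
have [ab'|ab'] := leqP a b.
  by apply: subset_trans (@cell_half b l') _; apply: IH => //; exact: cell_half.
have -> : a = b.+1 by lia.
have lx' : cell b.+1 l x by have <- : a = b.+1 by lia.
by rewrite (cell_uniq lx' l'x).
Qed.

Lemma cell0E : cell 0 (fun=> 0%N) = half_open_unit_cube R m.
Proof.
apply/seteqP; split => x.
  by move=> /cellP H i; have := H i; rewrite expr0 mul1r.
by move=> H; apply/cellP => i; rewrite expr0 mul1r; exact: H.
Qed.

Lemma cell0_only l x : half_open_unit_cube R m x -> cell 0 l x -> l = fun=> 0%N.
Proof. by rewrite -cell0E => x0 xl; exact: cell_uniq xl x0. Qed.

Lemma cellE n l : cell n l =
  box (fun i => `](l i)%:R / 2 ^+ n, (l i)%:R / 2 ^+ n + (2 ^+ n)^-1]%classic).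
Proof.
have E i : (l i)%:R / 2 ^+ n + (2 ^+ n)^-1 = (l i).+1%:R / 2 ^+ n :> R.
  by rewrite -[(l i).+1%:R]natr1 mulrDl mul1r.
apply/seteqP; split => x.
  move=> /cellP H i; have := H i; rewrite /= in_itv/= E ltr_pdivrMr ?exprn_gt0//.
  by rewrite ler_pdivlMr ?exprn_gt0// ![x _ _ * _]mulrC.
move=> H; apply/cellP => i; have := H i; rewrite /= in_itv/= E ltr_pdivrMr ?exprn_gt0//.
by rewrite ler_pdivlMr ?exprn_gt0// ![x _ _ * _]mulrC.
Qed.

Lemma measurable_cell n l : measurable (cell n l).
Proof. by rewrite cellE; apply: measurable_box => i; exact: measurable_itv. Qed.

Lemma measurable_half_open_unit_cube : measurable (half_open_unit_cube R m).
Proof. by rewrite -cell0E; exact: measurable_cell. Qed.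

End dyadic_cells.

(** * Stopping-time selection and counting *)

Lemma powR_exprn {R : realType} (a s : R) n : 0 <= a ->
  (a ^+ n) `^ s = (a `^ s) ^+ n.
Proof.
move=> a0; elim: n => [|n IH]; first by rewrite !expr0 powR1.
by rewrite !exprS powRM ?exprn_ge0// IH.
Qed.

Section stopping_cells.
Context {R : realType} {m : nat}.
Context (nu : {finite_measure set 'rV[R]_m -> \bar R}) (rho : R) (rho0 : 0 < rho).
Context (nu_cube : nu (~` half_open_unit_cube R m) = 0%E).

(** The weight is nu(Q) times the power rho of the side of Q. *)
Definition weight n (l : 'I_m -> nat) : R :=
  fine (nu (cell n l)) * (2 `^ (- rho)) ^+ n.

Lemma fineK_nu (B : set 'rV[R]_m) : measurable B -> (fine (nu B))%:E = nu B.
Proof. by move=> mB; rewrite fineK// fin_num_measure. Qed.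

Lemma fine_nu_le (B D : set 'rV[R]_m) : measurable B -> measurable D ->
  B `<=` D -> fine (nu B) <= fine (nu D).
Proof. by move=> mB mD BD; rewrite -lee_fin !fineK_nu// le_measure ?inE. Qed.

Lemma weight_ge0 n l : 0 <= weight n l.
Proof. by rewrite mulr_ge0 ?exprn_ge0 ?powR_ge0// fine_ge0. Qed.

Lemma weight_le a b l l' (x : 'rV[R]_m) : (a <= b)%N -> cell a l x -> cell b l' x ->
  weight b l' <= weight a l.
Proof.
move=> ab lx l'x; rewrite /weight ler_pM ?fine_ge0 ?exprn_ge0 ?powR_ge0//.
  by apply: fine_nu_le; [exact: measurable_cell..|exact: cell_sub lx l'x].
by rewrite ler_wiXn2l ?powR_ge0// ltW// powR2N_lt1.
Qed.

Lemma weight_le_total n l : weight n l <= fine (nu setT) * (2 `^ (- rho)) ^+ n.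
Proof.
rewrite ler_wpM2r ?exprn_ge0 ?powR_ge0//; apply: fine_nu_le => //.
exact: measurable_cell.
Qed.

Lemma weight_small t : 0 < t -> exists N, forall n l, (N <= n)%N -> weight n l < t.
Proof.
move=> t0; pose M := fine (nu setT) + 1.
have M0 : 0 < M by rewrite ltr_wpDl// fine_ge0.
have q1 : `|2 `^ (- rho)| < 1 :> R by rewrite ger0_norm ?powR_ge0// powR2N_lt1.
have /cvgrPdist_lt/(_ (t / M) (divr_gt0 t0 M0)) [N _ NP] := cvg_expr q1.
exists N => n l Nn; have := NP n Nn; rewrite /= sub0r normrN => H.
rewrite (le_lt_trans (weight_le_total n l))//.
apply: (@le_lt_trans _ _ (M * (2 `^ (- rho)) ^+ n)).
  by rewrite ler_wpM2r ?exprn_ge0 ?powR_ge0// lerDl.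
by rewrite mulrC -ltr_pdivlMr// (le_lt_trans _ H)// ler_norm.
Qed.

Section selection.
Context (t : R) (t0 : 0 < t) (N : nat).

(** Codes for the cells of level between 1 and N, by a parent cell of level n < N
    and the choice of a half in each coordinate.  The bound 2 ^ N on the indices is
    uniform in n, so that the type of the index does not depend on the level. *)
Definition slot : finType :=
  ('I_N * {ffun 'I_m -> 'I_(2 ^ N)} * {ffun 'I_m -> bool})%type.

Definition parent (z : slot) : 'I_m -> nat := fun i => z.1.2 i.
Definition child (z : slot) : 'I_m -> nat := fun i => ((z.1.2 i).*2 + z.2 i)%N.

(** A heavy cell has to be divided further; the selected cells are the light
    children of heavy cells. *)
Definition heavy : pred ('I_N * {ffun 'I_m -> 'I_(2 ^ N)}) :=
  fun y => t <= weight y.1 (fun i => y.2 i).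

Definition selected : pred slot := fun z =>
  heavy z.1 && (weight z.1.1.+1 (child z) < t).

Definition slot_cell (z : slot) : set 'rV[R]_m := cell z.1.1.+1 (child z).

Lemma child_half z : (fun i => (child z i)./2) = parent z.
Proof. by apply/funext => i; rewrite /child addnC half_bit_double. Qed.

Lemma slot_cell_parent z : slot_cell z `<=` cell z.1.1 (parent z).
Proof. by rewrite -child_half; exact: cell_half. Qed.

(** Of two selected cells through x, one of strictly deeper level would have a heavy
    parent contained in the other cell, which is light: this contradicts the
    monotonicity of the weight.  At equal level, cells through x coincide. *)
Lemma selected_disjoint z z' (x : 'rV[R]_m) : selected z -> selected z' ->
  slot_cell z x -> slot_cell z' x -> z = z'.
Proof.
move=> sz sz' zx z'x.
have aux y y' : selected y -> selected y' -> slot_cell y x -> slot_cell y' x ->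
    (y'.1.1 <= y.1.1)%N.
  move=> /andP[_ sy] /andP[sy' _] yx y'x; rewrite leqNgt; apply/negP => lt.
  have := weight_le lt yx (slot_cell_parent y'x).
  by rewrite leNgt (lt_le_trans sy sy').
have e : z.1.1 = z'.1.1.
  by apply/val_inj/eqP; rewrite eqn_leq (aux z' z)// (aux z z').
move: zx z'x; rewrite /slot_cell e => zx z'x.
have ce := cell_uniq zx z'x.
case: z z' e ce {sz sz' zx z'x aux} => [[n l] b] [[n' l'] b'] /= -> ce.
have H i : l i = l' i /\ b i = b' i.
  have := congr1 (@^~ i) ce; rewrite /child/= => E.
  split; first apply/val_inj => /=.
    by move: E; case: (b i); case: (b' i) => /=; lia.
  by move: E; case: (b i); case: (b' i) => /=; lia.
by congr (_, _, _); apply/ffunP => i; have [] := H i.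
Qed.

Context (HN : forall n l, (N <= n)%N -> weight n l < t).

(** The first light cell on the branch of x is selected.  It is not the whole cube,
    which is heavy by the bound on t, and it occurs before level N. *)
Lemma selected_cover (x : 'rV[R]_m) : t <= fine (nu (half_open_unit_cube R m)) ->
  half_open_unit_cube R m x -> exists2 z, selected z & slot_cell z x.
Proof.
move=> tnu xQ.
have [L LP] := choice (fun n => cell_exists n xQ).
have : exists n, weight n (L n) < t by exists N; exact: HN.
move=> /ex_minnP[[|n] nt nmin].
  move: nt; rewrite /weight expr0 mulr1 (cell0_only xQ (LP 0%N)) cell0E.
  by rewrite ltNge tnu.
have hn : t <= weight n (L n) by rewrite leNgt; apply/negP => /nmin; rewrite ltnn.
have nN : (n < N)%N.
  by rewrite ltnNge; apply/negP => Nn; have := @HN n (L n) Nn; rewrite ltNge hn.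
have LN i : (L n i < 2 ^ N)%N.
  by apply: leq_trans (cell_lt i xQ (LP n)) _; rewrite leq_exp2l// ltnW.
have Lh : (fun i => (L n.+1 i)./2) = L n by apply: cell_uniq (LP n); apply: cell_half.
pose z : slot := (Ordinal nN, [ffun i => Ordinal (LN i)], [ffun i => odd (L n.+1 i)]).
have cz : child z = L n.+1.
  apply/funext => i; rewrite /child/= !ffunE/= -[in RHS](odd_double_half (L n.+1 i)).
  by rewrite addnC -Lh.
have pz : (fun i => (z.1.2 i : nat)) = L n by apply/funext => i; rewrite /= ffunE.
exists z; first by rewrite /selected /heavy pz cz hn nt.
by rewrite /slot_cell cz.
Qed.

End selection.

Lemma card_selected t N : (#|@selected t N| <= #|@heavy t N| * 2 ^ m)%N.
Proof.
have -> : (2 ^ m = #|{: {ffun 'I_m -> bool}}|)%N.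
  by rewrite card_ffun card_bool card_ord.
rewrite -cardX; apply: subset_leq_card.
by apply/fintype.subsetP => z; rewrite !inE /= => /andP[h _]; apply/andP.
Qed.

Local Notation theta s := (2 `^ (- (rho * s))).

(** Chebyshev's inequality: t^s' <= weight^s' on a heavy cell, and
    nu(Q)^s' <= M^(s'-s) nu(Q)^s, where M is the total mass.  Heavy cells have positive measure, so
    they occur in the dyadic sum. *)
Lemma card_heavy_level t N (n : 'I_N) s s' : 0 < t -> 0 < s -> s <= s' ->
  ((#|[pred l : {ffun 'I_m -> 'I_(2 ^ N)} | @heavy t N (n, l)]|%:R * t `^ s')%:E <=
  (fine (nu setT) `^ (s' - s) * theta s' ^+ n)%:E *
  \esum_(C in dyadic_cubes nu n) (nu C `^ s))%E.
Proof.
move=> t0 s0 ss'.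
set B := [pred l | _]; pose M := fine (nu setT).
have Bw l : l \in B -> t `^ s' <= (M `^ (s' - s) * theta s' ^+ n) *
    fine (nu (cell n (fun i => l i : nat))) `^ s.
  rewrite inE /heavy/= => lB; set v := fine _.
  have v0 : 0 < v.
    rewrite lt_neqAle fine_ge0// andbT; apply/eqP => v0.
    by move: (lt_le_trans t0 lB); rewrite /weight -/v -v0 mul0r ltxx.
  have vM : v <= M by apply: fine_nu_le => //; exact: measurable_cell.
  apply: (@le_trans _ _ (weight n (fun i => l i : nat) `^ s')).
    by apply: ge0_ler_powR; rewrite ?nnegrE ?(ltW t0) ?weight_ge0// (le_trans (ltW s0)).
  rewrite /weight -/v powRM ?(ltW v0) ?exprn_ge0 ?powR_ge0//.
  have -> : ((2 `^ (- rho)) ^+ n) `^ s' = theta s' ^+ n :> R.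
    by rewrite powR_exprn ?powR_ge0// -powRrM mulNr.
  rewrite mulrAC ler_wpM2r ?exprn_ge0 ?powR_ge0//.
  have -> : v `^ s' = v `^ (s' - s) * v `^ s.
    by rewrite -powRD ?subrK// (gt_eqF v0)/= implybT.
  rewrite ler_wpM2r ?powR_ge0//; apply: ge0_ler_powR; rewrite ?nnegrE ?subr_ge0 ?(ltW v0)//.
  exact: fine_ge0.
have K0 : 0 <= M `^ (s' - s) * theta s' ^+ n by rewrite mulr_ge0 ?exprn_ge0 ?powR_ge0.
apply: (@le_trans _ _ ((M `^ (s' - s) * theta s' ^+ n)%:E *
    (\sum_(l in B) fine (nu (cell n (fun i => l i : nat))) `^ s)%:E)%E).
  rewrite -EFinM lee_fin -sum1_card natr_sum mulr_suml mulr_sumr.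
  by apply: ler_sum => l lB; rewrite mul1r; exact: Bw.
apply: lee_wpmul2l; first by rewrite lee_fin.
pose e (l : {ffun 'I_m -> 'I_(2 ^ N)}) : set 'rV[R]_m := cell n (fun i => l i : nat).
have Be l : l \in B -> 0 < fine (nu (e l)).
  rewrite inE /heavy/= => lB.
  rewrite lt_neqAle fine_ge0// andbT; apply/eqP => v0.
  by move: (lt_le_trans t0 lB); rewrite /weight -v0 mul0r ltxx.
have inje : set_inj [set` B] e.
  move=> l l' /set_mem /= lB _ ell'.
  have [x xl] : e l !=set0.
    apply/set0P/negP => /eqP e0; have := Be _ lB.
    by rewrite e0 measure0 ltxx.
  have xl' : e l' x by rewrite -ell'.
  by apply/ffunP => i; apply/val_inj; have := congr1 (@^~ i) (cell_uniq xl xl').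
apply: esum_ge; exists [set e l | l in [set` B]].
  split; first by apply: finite_image; exact: finite_finset.
  move=> _ [l lB <-]; split; first by exists (fun i => (l i)%:Z).
  have := Be _ lB; rewrite -lte_fin fineK_nu//; exact: measurable_cell.
rewrite fsbig_image//= -sumEFin bigfs ?index_enum_uniq//; last first.
  by move=> l _; rewrite mem_index_enum.
rewrite le_eqVlt; apply/orP; left; apply/eqP; apply: eq_fsbigr => l _.
rewrite -poweR_EFin; congr (_ `^ _)%E; apply: fineK_nu; exact: measurable_cell.
Qed.

Lemma dyadic_sum_le n s b : (0 < n)%N -> (beta_at nu n s <= b%:E)%E ->
  (\esum_(C in dyadic_cubes nu n) (nu C `^ s) <= ((2 ^+ n) `^ b)%:E)%E.
Proof.
move=> n0; rewrite /beta_at; set S := (\esum_(C in _) _)%E.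
have S0 : (0 <= S)%E by apply: esum_ge0 => C _; exact: poweR_ge0.
have l0 : 0 < ln (2 ^+ n) :> R by rewrite ln_gt0// exprn_egt1 ?ltr1n// -lt0n.
case: S S0 => [S|_|//]; last first.
  by rewrite /= inver (gt_eqF l0) gt0_mulye ?lte_fin ?invr_gt0.
rewrite !lee_fin => S0; have [Sle0|Sgt0] := leP S 0.
  by move=> _; rewrite (le_trans Sle0)// powR_ge0.
rewrite lne_EFin// inver (gt_eqF l0) -EFinM lee_fin ler_pdivrMr// => H.
rewrite /powR gt_eqF ?exprn_gt0// -ler_ln ?posrE ?expR_gt0// expRK//.
Qed.

(** A cell that sticks out of the unit cube is disjoint from it, hence of measure
    zero. *)
Lemma heavy_lt (t : R) N (n : 'I_N) (l : {ffun 'I_m -> 'I_(2 ^ N)}) : 0 < t ->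
  @heavy t N (n, l) -> forall i, (l i < 2 ^ n)%N.
Proof.
move=> t0; rewrite /heavy/= => lt i.
have : 0 < fine (nu (cell n (fun i => l i : nat))).
  rewrite lt_neqAle fine_ge0// andbT; apply/eqP => v0.
  by move: (lt_le_trans t0 lt); rewrite /weight -v0 mul0r ltxx.
have [[x [xl xQ]]|H] := pselect (exists x, cell n (fun i => l i : nat) x /\
    half_open_unit_cube R m x).
  by move=> _; exact: cell_lt xQ xl.
rewrite (_ : nu _ = 0%E) ?ltxx//; apply/eqP; rewrite eq_le measure_ge0 andbT.
rewrite -nu_cube; apply: le_measure; rewrite ?inE.
- exact: measurable_cell.
- by apply: measurableC; exact: measurable_half_open_unit_cube.
- by move=> x xl xQ; apply: H; exists x.
Qed.

Lemma card_heavy_small N (t : R) (n : 'I_N) : 0 < t ->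
  (#|[pred l : {ffun 'I_m -> 'I_(2 ^ N)} | @heavy t N (n, l)]| <= (2 ^ n) ^ m)%N.
Proof.
move=> t0; pose P := [pred a : 'I_(2 ^ N) | (a < 2 ^ n)%N].
have PE : (#|P| <= 2 ^ n)%N.
  rewrite -[leqRHS](size_iota 0) cardE -(size_map val); apply: uniq_leq_size.
    by rewrite map_inj_uniq ?enum_uniq//; exact: val_inj.
  by move=> _ /mapP[a + ->]; rewrite mem_enum mem_iota inE.
apply: (@leq_trans (#|P| ^ #|'I_m|)%N).
  rewrite -card_ffun_on; apply: subset_leq_card; apply/fintype.subsetP => l.
  rewrite inE /= => lt; apply/ffun_onP => i; rewrite inE /=; exact: heavy_lt lt i.
rewrite card_ord.
by elim: m => // k IH; rewrite !expnS leq_mul.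
Qed.

Lemma card_heavy t N : #|@heavy t N| =
  (\sum_(n < N) #|[pred l : {ffun 'I_m -> 'I_(2 ^ N)} | @heavy t N (n, l)]|)%N.
Proof.
rewrite -sum1_card (eq_bigl (fun y => @heavy t N (y.1, y.2))); last by case.
rewrite -(pair_big_dep xpredT (fun n l => @heavy t N (n, l)) (fun _ _ => 1%N)).
by apply: eq_bigr => n _; rewrite sum1_card.
Qed.

Lemma sum_lt_le N n1 : \sum_(n < N) ((n < n1)%N%:R : R) <= n1%:R.
Proof.
have -> : \sum_(n < N) ((n < n1)%N%:R : R) = (minn N n1)%:R.
  elim: N => [|N IH]; first by rewrite big_ord0 min0n.
  by rewrite big_ord_recr/= IH -natrD; congr _%:R; case: ltnP; lia.
by rewrite ler_nat geq_minr.
Qed.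

(** The levels n >= n1, on which the spectrum at s controls the dyadic sum, are
    bounded by a geometric series; the finitely many others by the number of all
    cells. *)
Lemma card_selected_le s s' : 0 < s -> s < s' ->
  (Lq_spectrum nu s - (rho * s)%:E <= 0)%E ->
  exists2 K, 0 <= K & forall t N, 0 < t -> t <= 1 ->
    #|@selected t N|%:R <= K * t `^ (- s').
Proof.
move=> s0 ss' Hs; pose eps := rho * (s' - s) / 2.
have eps0 : 0 < eps by rewrite divr_gt0 ?mulr_gt0 ?subr_gt0.
have : (Lq_spectrum nu s < (rho * s + eps)%:E)%E.
  move: Hs; rewrite sube_le0 => /le_lt_trans; apply.
  by rewrite lte_fin ltrDl.
rewrite /Lq_spectrum /limn_esup /limf_esup => /ereal_inf_lt[_ [A [n0 _ n0A] <-]] Hsup.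
have Hbeta n : (n0 <= n)%N -> (beta_at nu n s <= (rho * s + eps)%:E)%E.
  move=> nn; apply: (le_trans _ (ltW Hsup)); apply: ereal_sup_ubound.
  by exists n => //; exact: n0A.
pose n1 := n0.+1; pose M := fine (nu setT) `^ (s' - s).
pose q := 2 `^ (- eps) : R; pose c : R := ((2 ^ n1) ^ m)%:R.
have M0 : 0 <= M by exact: powR_ge0.
have q0 : 0 <= q by exact: powR_ge0.
have q1 : q < 1 by exact: powR2N_lt1.
have c0 : 0 <= c by exact: ler0n.
have lev t N (n : 'I_N) : 0 < t -> t <= 1 ->
    #|[pred l : {ffun 'I_m -> 'I_(2 ^ N)} | @heavy t N (n, l)]|%:R * t `^ s' <=
    M * q ^+ n + c * (n < n1)%N%:R.
  move=> t0 t1; have [nn1|n1n] := ltnP n n1.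
    rewrite mulr1 ler_wpDl ?mulr_ge0 ?exprn_ge0//.
    rewrite -[leRHS]mulr1 ler_pM ?powR_ge0//.
      rewrite ler_nat (leq_trans (card_heavy_small n t0))// //.
      by rewrite -!expnM leq_exp2l// leq_mul2r ltnW ?orbT.
    rewrite -(powRr0 t); apply: ger_powR; first by rewrite t0 t1.
    by rewrite ltW// (lt_trans s0).
  rewrite mulr0 addr0 -lee_fin.
  apply: (le_trans (card_heavy_level n t0 s0 (ltW ss'))).
  have n_gt0 : (0 < n)%N by apply: leq_trans n1n.
  apply: (le_trans (lee_wpmul2l _ (dyadic_sum_le n_gt0 (Hbeta n (ltnW n1n))))).
    by rewrite lee_fin mulr_ge0 ?exprn_ge0 ?powR_ge0.
  rewrite -EFinM lee_fin -mulrA powR_exprn// -exprMn -powRD; last by rewrite pnatr_eq0 implybT.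
  (* eps is half of the gap rho s' - rho s. *)
  rewrite (_ : - (rho * s') + (rho * s + eps) = - eps)//.
  by rewrite /eps; field.
pose K0 := M / (1 - q) + c * n1%:R.
have K00 : 0 <= K0 by rewrite addr_ge0 ?mulr_ge0 ?invr_ge0 ?subr_ge0 ?(ltW q1).
exists (K0 * (2 ^ m)%:R); first by rewrite mulr_ge0.
move=> t N t0 t1.
apply: (@le_trans _ _ (#|@heavy t N|%:R * (2 ^ m)%:R)).
  by rewrite -natrM ler_nat card_selected.
rewrite mulrAC ler_wpM2r// powRN ler_pdivlMr ?powR_gt0//.
rewrite card_heavy natr_sum mulr_suml.
apply: (le_trans (ler_sum _ (fun n _ => lev t N n t0 t1))).
rewrite big_split/= -!mulr_sumr lerD ?ler_wpM2l ?sum_lt_le//.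
rewrite -[leRHS]mul1r ler_pdivlMr ?subr_gt0// mulrC.
have := subrX1 q N => /(congr1 -%R); rewrite opprB -mulNr opprB => <-.
by rewrite lerBlDr lerDl exprn_ge0.
Qed.

End stopping_cells.

(** * Approximation on the selected cells *)

(** A subspace of dimension at most n is given by exactly n vectors: the family g is
    enumerated and completed by zeros. *)
Lemma finite_span_subspace (R : realType) (V : lmodType R) (I : finType) (g : I -> V) n :
  (#|I| <= n)%N -> exists2 S, subspaces_dim_le n S &
    forall c : I -> R, S (\sum_i c i *: g i).
Proof.
move=> In.
pose at_index (U : nmodType) (h : I -> U) (j : nat) : U :=
  if insub j is Some a then h (@enum_val I I a) else 0.
exists [set (\sum_(j < n) c j *: at_index V g j)%R | c in [set: 'I_n -> R]].
  by exists (fun j : 'I_n => at_index V g j).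
move=> c; exists (fun j : 'I_n => at_index R c j) => //.
transitivity (\sum_(j < #|I|) at_index R c j *: at_index V g j).
  rewrite [RHS](big_ord_widen n (fun j => at_index R c j *: at_index V g j))//.
  rewrite [RHS]big_mkcond; apply: eq_bigr => j _; rewrite /at_index.
  by case: ltnP => // Ij; rewrite insubN ?scale0r// -leqNgt.
rewrite [RHS](reindex (@enum_val I I)); last exact/onW_bij/enum_val_bij.
by apply: eq_bigr => a _; rewrite /at_index !valK.
Qed.

Section diameter.
Context {R : realType} {m : nat} (nu : {finite_measure set 'rV[R]_m -> \bar R}) (q : R).
Context (q1 : (1 <= q%:E)%E).

Lemma bounded_Lfun (h : 'rV[R]_m -> R) (M : R) : measurable_fun setT h ->
  (forall x, `|h x| <= M) -> h \in Lfun nu q%:E.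
Proof.
move=> mh hM; have q0 : 0 < q by rewrite (lt_le_trans ltr01).
have M0 : 0 <= M by apply: le_trans (hM 0).
rewrite inE; apply/andP; split; rewrite inE//=.
rewrite /finite_norm unlock poweR_lty//.
apply: (@le_lt_trans _ _ (\int[nu]_x (M `^ q)%:E)%E); last first.
  by rewrite integral_cst// lte_mul_pinfty ?lee_fin ?powR_ge0// ltey_eq fin_num_measure.
have mhq : measurable_fun setT (fun x => (`|h x| `^ q)%:E).
  apply/measurable_EFinP; apply: (measurableT_comp (measurable_powR q)).
  exact: measurableT_comp.
apply: ge0_le_integral => //.
- by move=> x _; exact: poweR_ge0.
- by move=> x _ /=; rewrite lee_fin ge0_ler_powR ?nnegrE// ltW.
Qed.

Lemma LfunType_sumE (I : Type) (s : seq I) (c : I -> R) (h : I -> LfunType nu q1) x :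
  (\sum_(i <- s) c i *: h i : LfunType nu q1) x = \sum_(i <- s) c i * h i x.
Proof.
elim: s => [|i s IH]; first by rewrite !big_nil.
by rewrite !big_cons -IH.
Qed.

End diameter.

Lemma term_le_sum (R : realType) (I : finType) (P : pred I) (F : I -> R) i :
  P i -> (forall j, P j -> 0 <= F j) -> F i <= \sum_(j | P j) F j.
Proof.
move=> Pi F0; rewrite (bigD1 i)//= lerDl.
by apply: sumr_ge0 => j /andP[Pj _]; exact: F0.
Qed.

Section partition_approximation.
Context {R : realType} {m : nat} (nu : {finite_measure set 'rV[R]_m -> \bar R}).
Context (k : nat) (p q : R) (p1 : 1 < p) (pq : p <= q).
Let delta := k.+1%:R - m%:R / p.
Let rho := q * delta.
Context (rho0 : 0 < rho).
Context (nu_cube : nu (~` half_open_unit_cube R m) = 0%E).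
Local Notation Lambda := (lebesgue_measure_rV R m).
Local Notation Omega := (open_unit_cube R m).
Context (t : R) (t0 : 0 < t) (N : nat).
Local Notation sel := (@selected R m nu rho t N).

Definition slot_corner (z : @slot m N) (i : 'I_m) : R := (child z i)%:R / 2 ^+ z.1.1.+1.
Definition slot_side (z : @slot m N) : R := (2 ^+ z.1.1.+1)^-1.
(** The gradient is integrated over the open cubes, which are contained in the open
    unit cube, whereas the cells may meet its boundary. *)
Definition slot_open (z : @slot m N) : set 'rV[R]_m :=
  open_cube (slot_corner z) (slot_side z).

Lemma slot_side_gt0 z : 0 < slot_side z.
Proof. by rewrite invr_gt0 exprn_gt0. Qed.

Lemma slot_open_sub z : slot_open z `<=` slot_cell z.
Proof.
rewrite /slot_cell cellE => x xz i; have := xz i.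
by rewrite /= !in_itv/= => /andP[-> /ltW ->].
Qed.

Lemma slot_cell_bounds z x : slot_cell z x ->
  forall i, slot_corner z i <= x ord0 i <= slot_corner z i + slot_side z.
Proof.
rewrite /slot_cell cellE => xz i; have := xz i.
by rewrite /= in_itv/= => /andP[/ltW -> ->].
Qed.

Lemma slot_corner_ge0 z i : 0 <= slot_corner z i.
Proof. by rewrite divr_ge0. Qed.

Lemma slot_corner_le1 z i : sel z -> slot_corner z i + slot_side z <= 1.
Proof.
case: z => [[n l] b] /andP[hz _]; rewrite /slot_corner /slot_side /=.
rewrite -[X in _ + X]mul1r -mulrDl natr1 ler_pdivrMr ?exprn_gt0// mul1r -natrX ler_nat.
have := heavy_lt nu_cube t0 hz i; rewrite /child/= expnS.
by case: (b i) => /=; lia.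
Qed.

Lemma energy_sum f : sobolev_sphere k.+1 p f ->
  (\int[Lambda]_(v in Omega) (gradient_norm Omega k.+1 f v `^ p)%:E <= 1)%E.
Proof.
move=> [fW _]; rewrite /sobolev_norm => norm1.
have p0 : 0 < p by rewrite (lt_trans _ p1).
have : (Lp_norm_on Omega p (gradient_norm Omega k.+1 f) <= 1)%E.
  by rewrite -norm1 leeDr// Lnorm_ge0.
rewrite /Lp_norm_on => H.
move: H; rewrite unlock; set X := (\int[_]_x _)%E => H.
have X0 : (0 <= X)%E by apply: integral_ge0 => v _; exact: poweR_ge0.
have -> : (\int[Lambda]_(v in Omega) (gradient_norm Omega k.+1 f v `^ p)%:E = X)%E.
  rewrite integral_mkcond; apply: eq_integral => v _; rewrite /= !patchE.
  case: ifPn => // _; first by rewrite ger0_norm ?gradient_norm_ge0.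
  by rewrite (_ : point = 0 :> R)// normr0 powR0 ?gt_eqF.
have := @gt0_ler_poweR _ p (ltW p0) (X `^ p^-1)%E 1%E.
rewrite -poweRrM mulVf ?gt_eqF// poweRe1// poweR1r; apply => //.
- by rewrite in_itv/= poweR_ge0 leey.
- by rewrite in_itv/= lee01 leey.
Qed.

Definition slot_energy f (z : @slot m N) : R :=
  fine (\int[Lambda]_(v in slot_open z) (gradient_norm Omega k.+1 f v `^ p)%:E).

Lemma slot_energy_ge0 f z : 0 <= slot_energy f z.
Proof. by rewrite fine_ge0// integral_ge0// => v _; rewrite lee_fin powR_ge0. Qed.

(** The open cubes are disjoint and contained in the unit cube, on which the energy
    is at most 1. *)
Lemma slot_energy_sum f : sobolev_sphere k.+1 p f ->
  (forall z, sel z -> (\int[Lambda]_(v in slot_open z)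
    (gradient_norm Omega k.+1 f v `^ p)%:E = (slot_energy f z)%:E)%E) /\
  \sum_(z | sel z) slot_energy f z <= 1.
Proof.
move=> fS; have fW : sobolev Omega k.+1 p f by case: fS.
have mg : measurable_fun Omega (fun v => (gradient_norm Omega k.+1 f v `^ p)%:E).
  apply/measurable_EFinP; apply: (measurableT_comp (measurable_powR p)).
  exact: measurable_gradient_norm fW.
have sO z : sel z -> slot_open z `<=` Omega.
  move=> sz; apply: open_cube_sub; first by move=> i; exact: slot_corner_ge0.
  by move=> i; exact: slot_corner_le1.
have mz z : measurable (slot_open z) by exact: measurable_open_cube.
have H : (\sum_(z <- enum sel) \int[Lambda]_(v in slot_open z)
    (gradient_norm Omega k.+1 f v `^ p)%:E <= 1)%E.
  have sU : \big[setU/set0]_(z <- enum sel) slot_open z `<=` Omega.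
    rewrite -bigcup_seq => v [z /=]; rewrite mem_enum => sz; exact: sO.
  have mU : measurable (\big[setU/set0]_(z <- enum sel) slot_open z).
    by apply: bigsetU_measurable => z _; exact: mz.
  rewrite -ge0_integral_bigsetU ?enum_uniq//.
  - apply: le_trans (energy_sum fS); apply: ge0_subset_integral => //.
      exact: measurable_open_unit_cube.
    by move=> v _; rewrite lee_fin powR_ge0.
  - move=> z z' /=; rewrite !mem_enum => sz sz' [v [vz vz']].
    by apply: selected_disjoint sz sz' (slot_open_sub vz) (slot_open_sub vz').
  - by apply: measurable_funS mg => //; exact: measurable_open_unit_cube.
  - by move=> v _; rewrite lee_fin powR_ge0.
have E z : sel z -> (\int[Lambda]_(v in slot_open z)
    (gradient_norm Omega k.+1 f v `^ p)%:E = (slot_energy f z)%:E)%E.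
  move=> sz; rewrite /slot_energy fineK// ge0_fin_numE; last first.
    by apply: integral_ge0 => v _; rewrite lee_fin powR_ge0.
  apply: le_lt_trans (ltry 1); apply: le_trans (energy_sum fS).
  apply: ge0_subset_integral => //; last exact: sO.
    exact: measurable_open_unit_cube.
  by move=> v _; rewrite lee_fin powR_ge0.
split => //; rewrite -lee_fin -sumEFin; apply: le_trans H.
rewrite le_eqVlt; apply/orP; left; apply/eqP; rewrite big_enum/=.
by apply: eq_bigr => z sz; rewrite E.
Qed.

Lemma slot_side_powR z : (slot_side z `^ delta) `^ q = (2 `^ (- rho)) ^+ z.1.1.+1.
Proof.
rewrite -powRrM [delta * q]mulrC -/rho.
have := @powR_half_pow R 1 rho z.1.1.+1 ler01.
by rewrite /slot_side mul1r powR1 mul1r.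
Qed.

(** The power q of the local error is at most C^q r^rho A^(q/p), and r^rho nu(Q) is
    the weight, at most t on a selected cell.  As A <= 1 and q >= p, one has
    A^(q/p) <= A, and the energies sum to at most 1. *)
Lemma slot_error_sum (C : R) f : 0 <= C -> sobolev_sphere k.+1 p f ->
  \sum_(z | sel z) (C * (slot_side z `^ delta * slot_energy f z `^ p^-1)) `^ q *
     fine (nu (slot_cell z)) <= C `^ q * t.
Proof.
move=> C0 fS; have [_ A1] := slot_energy_sum fS.
have p0 : 0 < p by rewrite (lt_trans _ p1).
have q0 : 0 < q by rewrite (lt_le_trans p0).
have Ale z : sel z -> slot_energy f z <= 1.
  move=> sz; apply: le_trans A1; rewrite (bigD1 z)//= lerDl.
  by apply: sumr_ge0 => *; exact: slot_energy_ge0.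
have Apow z : sel z -> (slot_energy f z `^ p^-1) `^ q <= slot_energy f z.
  move=> sz; rewrite -powRrM; have := slot_energy_ge0 f z.
  rewrite le_eqVlt => /predU1P[<-|Ap].
    by rewrite powR0// mulf_neq0 ?invr_eq0 ?gt_eqF.
  by apply: ge1r_powR; rewrite ?Ap ?Ale// mulrC ler_pdivlMr// mul1r.
apply: (@le_trans _ _ (\sum_(z | sel z) C `^ q * t * slot_energy f z)); last first.
  by rewrite -mulr_sumr ler_piMr// mulr_ge0 ?powR_ge0// ltW.
apply: ler_sum => z sz; rewrite powRM ?mulr_ge0 ?powR_ge0//.
rewrite powRM ?powR_ge0// slot_side_powR -!mulrA ler_wpM2l ?powR_ge0//.
rewrite mulrA [X in X * _]mulrC -mulrA mulrC ler_pM ?powR_ge0 ?Apow//.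
  by rewrite mulr_ge0 ?exprn_ge0 ?powR_ge0// fine_ge0.
by move: sz => /andP[_ /ltW]; rewrite /weight mulrC.
Qed.

Context (tnu : t <= fine (nu (half_open_unit_cube R m))).
Context (HN : forall n (l : 'I_m -> nat), (N <= n)%N -> weight nu rho n l < t).
Context (q1 : (1 <= q%:E)%E) (C : R) (C0 : 0 <= C).
Context (HC : forall f : 'rV[R]_m -> R, sobolev Omega k.+1 p f ->
  {within closed_unit_cube R m, continuous f} ->
  forall (c : 'I_m -> R) (r : R), 0 < r ->
  (forall i, 0 <= c i) -> (forall i, c i + r <= 1) ->
  forall A : R, 0 <= A ->
  (\int[Lambda]_(v in open_cube c r)
     (gradient_norm Omega k.+1 f v `^ p)%:E <= A%:E)%E ->
  exists coef : {ffun 'I_m -> 'I_k.+1} -> R, forall x : 'rV[R]_m,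
    (forall i, c i <= x ord0 i <= c i + r) ->
    `|f x - \sum_al coef al * monomial al x| <= C * (r `^ delta * A `^ p^-1)).

Definition local_monomial (z : @slot m N) (al : {ffun 'I_m -> 'I_k.+1}) (x : 'rV[R]_m) : R :=
  \1_(slot_cell z `&` half_open_unit_cube R m) x * monomial al x.

Lemma local_monomial_Lfun z al : local_monomial z al \in Lfun nu q%:E.
Proof.
apply: (@bounded_Lfun _ _ nu q q1 _ 1).
  apply: measurable_funM.
    apply: measurable_indic; apply: measurableI; first exact: measurable_cell.
    exact: measurable_half_open_unit_cube.
  by apply: (@measurable_prod_coord _ _ (fun i y => y ^+ al i)) => i; exact: exprn_measurable.
move=> x; rewrite /local_monomial indicE; case: (boolP (x \in _)) => [|_].
  rewrite inE => -[_ xQ]; rewrite mul1r normr_prod.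
  apply: (@le_trans _ _ (\prod_(i < m) 1)); last by rewrite big1.
  apply: ler_prod => i _; have /andP[x0 x1] := xQ i.
  by rewrite normr_ge0 normrX exprn_ile1// ger0_norm// ltW.
by rewrite mul0r normr0.
Qed.

(** Almost every point lies in a selected cell, so that |g - y|^q is dominated by
    the step function whose value on a cell is the local error bound. *)
Lemma approximation_error (f g y : 'rV[R]_m -> R) (coef : @slot m N -> {ffun 'I_m -> 'I_k.+1} -> R) :
  sobolev_sphere k.+1 p f -> measurable_fun setT g -> measurable_fun setT y ->
  {ae nu, forall x, g x = f x} ->
  (forall z x, sel z -> slot_cell z x ->
    `|f x - \sum_al coef z al * monomial al x| <=
    C * (slot_side z `^ delta * slot_energy f z `^ p^-1)) ->
  (forall z x, sel z -> slot_cell z x -> half_open_unit_cube R m x ->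
     y x = \sum_al coef z al * monomial al x) ->
  (\int[nu]_x (`|g x - y x| `^ q)%:E <= (C `^ q * t)%:E)%E.
Proof.
move=> fS mg my gf err yE.
have p0 : 0 < p by rewrite (lt_trans _ p1).
have q0 : 0 < q by rewrite (lt_le_trans p0).
pose b z := (C * (slot_side z `^ delta * slot_energy f z `^ p^-1)) `^ q.
pose B (x : 'rV[R]_m) : R := \sum_(z | sel z) b z * \1_(slot_cell z) x.
have b0 z : 0 <= b z by exact: powR_ge0.
have bsum : \sum_(z | sel z) b z * fine (nu (slot_cell z)) <= C `^ q * t.
  exact: slot_error_sum.
have berr z x : sel z -> slot_cell z x -> half_open_unit_cube R m x ->
    `|f x - y x| `^ q <= b z.
  move=> sz zx xQ; apply: ge0_ler_powR; rewrite ?nnegrE ?(ltW q0)//.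
    by rewrite !mulr_ge0 ?powR_ge0.
  by rewrite (yE z x)//; exact: err.
clearbody b.
have mB : measurable_fun setT (fun x => (B x)%:E).
  apply/measurable_EFinP; rewrite /B; under eq_fun do rewrite big_mkcond/=.
  apply: measurable_sum => z; case: (sel z); last exact: measurable_cst.
  apply: measurable_funM => //; apply: measurable_indic; exact: measurable_cell.
apply: (@le_trans _ _ (\int[nu]_x (B x)%:E)%E).
  apply: ae_ge0_le_integral => //.
  - apply/measurable_EFinP; apply: (measurableT_comp (measurable_powR q)).
    by apply: measurableT_comp => //; exact: measurable_funB.
  - move=> x _; rewrite lee_fin; apply: sumr_ge0 => z _; rewrite mulr_ge0//.
  have xQ : {ae nu, forall x, half_open_unit_cube R m x}.
    exists (~` half_open_unit_cube R m); split => //.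
    by apply: measurableC; exact: measurable_half_open_unit_cube.
  apply: filterS2 gf xQ => x gfx xQ _; rewrite lee_fin gfx.
  have [z sz zx] := selected_cover HN tnu xQ.
  apply: (le_trans (berr z x sz zx xQ)).
  rewrite -[leLHS]mulr1 -[X in b z * X](_ : \1_(slot_cell z) x = 1).
    by apply: (@term_le_sum _ _ sel (fun z => b z * \1_(slot_cell z) x)) => // z' _; rewrite mulr_ge0.
  by rewrite indicE mem_set.
apply: le_trans (_ : (\sum_(z | sel z) b z * fine (nu (slot_cell z)))%:E <= _)%E; last first.
  by rewrite lee_fin.
have -> : (fun x => (B x)%:E) = (fun x => \sum_(z | sel z) (b z)%:E * (\1_(slot_cell z) x)%:E)%E.
  by apply/funext => x; rewrite /B -sumEFin.
under [in leLHS]eq_fun do rewrite -big_filter.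
rewrite ge0_integral_sum//; last 2 first.
- move=> z; apply/measurable_EFinP; apply: measurable_funM => //.
  by apply: measurable_indic; exact: measurable_cell.
- by move=> z x _; rewrite -EFinM lee_fin mulr_ge0.
rewrite big_filter -sumEFin; apply: lee_sum => z sz.
rewrite ge0_integralZl//; last first.
- by rewrite lee_fin.
- by apply/measurable_EFinP; apply: measurable_indic; exact: measurable_cell.
rewrite integral_indic ?setIT//; last exact: measurable_cell.
by rewrite EFinM fineK_nu//; exact: measurable_cell.
Qed.

(** The approximating space is spanned by the monomials of coordinate degree at most
    k cut off to the selected cells: k.+1 ^ m functions for each cell. *)
Lemma diameter_le n : (#|sel| * k.+1 ^ m <= n)%N ->
  (kolmogorov_diameter (Lq_norm nu q1) (sobolev_sphere_in_Lq nu q1 k.+1 p) n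
   <= (C * t `^ q^-1)%:E)%E.
Proof.
move=> seln.
have p0 : 0 < p by rewrite (lt_trans _ p1).
have q0 : 0 < q by rewrite (lt_le_trans p0).
pose I : finType := ({z : @slot m N | sel z} * {ffun 'I_m -> 'I_k.+1})%type.
pose h (i : I) : LfunType nu q1 := Lfun_Sub q1 (local_monomial_Lfun (val i.1) i.2).
have [|S Sn SP] := @finite_span_subspace R _ I h n.
  rewrite card_prod card_sig card_ffun !card_ord; exact: seln.
rewrite /kolmogorov_diameter.
apply: (le_trans (ereal_inf_lbound (ex_intro2 _ _ S Sn erefl))).
apply: ge_ereal_sup => _ [g [f fS gf] <-].
have [fW cf _] := fS; have [AE _] := slot_energy_sum fS.
have ex z : exists coef : {ffun 'I_m -> 'I_k.+1} -> R, sel z -> forall x : 'rV[R]_m,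
    (forall i, slot_corner z i <= x ord0 i <= slot_corner z i + slot_side z) ->
    `|f x - \sum_al coef al * monomial al x| <=
    C * (slot_side z `^ delta * slot_energy f z `^ p^-1).
  have [sz|nsz] := boolP (sel z); last by exists (fun=> 0).
  have en : (\int[Lambda]_(v in open_cube (slot_corner z) (slot_side z))
      (gradient_norm Omega k.+1 f v `^ p)%:E <= (slot_energy f z)%:E)%E.
    by rewrite -/(slot_open z) AE.
  have [coef coefP] := HC fW cf (slot_side_gt0 z) (slot_corner_ge0 z)
    (fun i => slot_corner_le1 i sz) (slot_energy_ge0 f z) en.
  by exists coef.
have [coef coefP] := choice ex.
pose y : LfunType nu q1 := \sum_(i : I) coef (val i.1) i.2 *: h i.
apply: (@le_trans _ _ (Lq_norm nu q1 (g - y))).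
  by apply: ereal_inf_lbound; exists y => //; exact: SP.
have yE z x : sel z -> slot_cell z x -> half_open_unit_cube R m x ->
     (y : 'rV[R]_m -> R) x = \sum_al coef z al * monomial al x.
  move=> sz zx xQ; rewrite /y LfunType_sumE.
  rewrite -(pair_big xpredT xpredT (fun (z : {z | sel z}) al => coef (val z) al * h (z, al) x))/=.
  rewrite (bigD1 (Sub z sz : {z | sel z}))//= [X in _ + X]big1 ?addr0.
    apply: eq_bigr => al _; rewrite /h /= /local_monomial indicE mem_set ?mul1r//.
  move=> z' z'z; rewrite big1// => al _; rewrite /h /= /local_monomial indicE memNset ?mul0r ?mulr0//.
  move=> -[z'x _]; move/eqP: z'z; apply; apply/val_inj.
  exact: selected_disjoint (valP z') sz z'x zx.
have H : (\int[nu]_x (`|g x - y x| `^ q)%:E <= (C `^ q * t)%:E)%E.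
  apply: (approximation_error fS _ _ gf _ yE) => // z x sz zx.
  exact: coefP sz _ (slot_cell_bounds zx).
rewrite /Lq_norm unlock.
have -> : C * t `^ q^-1 = (C `^ q * t) `^ q^-1.
  by rewrite powRM ?powR_ge0 ?(ltW t0)// -powRrM mulfV ?gt_eqF// powRr1.
rewrite -poweR_EFin; apply: gt0_ler_poweR.
- by rewrite invr_ge0 ltW.
- by rewrite in_itv/= leey integral_ge0// => x _; exact: poweR_ge0.
- by rewrite in_itv/= leey lee_fin mulr_ge0 ?powR_ge0// ltW.
- exact: H.
Qed.

End partition_approximation.

(** * The approximation order *)

Lemma lne_le_EFin (R : realType) (x : \bar R) (L : R) :
  (x <= (expR L)%:E)%E -> (lne x <= L%:E)%E.
Proof.
case: x => [r|//|_]; last by rewrite leNye.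
rewrite lee_fin => rL /=; case: ifPn => [_|]; first by rewrite leNye.
rewrite -ltNge => r0; rewrite lee_fin -(expRK L) ler_ln ?posrE ?expR_gt0//.
Qed.

(** The constant b contributes b / ln n, which is at most e as soon as
    ln n > |b| / e. *)
Lemma limn_esup_lne_ln (R : realType) (d : nat -> \bar R) (a b : R) n0 :
  (forall n, (n0 <= n)%N -> (d n <= (expR (b - a * ln n%:R))%:E)%E) ->
  (limn_esup (fun n => lne (d n) / (ln n%:R)%:E) <= (- a)%:E)%E.
Proof.
move=> dn; apply/lee_addgt0Pr => e e0.
pose N := maxn n0 (Num.truncn (expR (`|b| / e + 1))).+1.
have NP n : (N <= n)%N -> (n0 <= n)%N /\ `|b| / e + 1 < ln n%:R.
  rewrite geq_max => /andP[n0n nN]; split => //.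
  have lt : expR (`|b| / e + 1) < n%:R.
    by apply: (lt_le_trans (truncnS_gt _)); rewrite ler_nat.
  by rewrite -(expRK (_ + 1)) ltr_ln ?posrE ?expR_gt0// (lt_trans (expR_gt0 _) lt).
rewrite /limn_esup /limf_esup; apply: ge_ereal_inf.
exists (ereal_sup [set (lne (d n) / (ln n%:R)%:E)%E | n in [set n | (N <= n)%N]]).
  by exists [set n | (N <= n)%N] => //; exists N.
apply: ge_ereal_sup => _ [n /NP[n0n lnn] <-].
have l0 : 0 < ln n%:R :> R.
  by apply: lt_trans lnn; rewrite ltr_wpDl// divr_ge0// ltW.
rewrite inver (gt_eqF l0).
apply: (@le_trans _ _ ((b - a * ln n%:R)%:E * ((ln n%:R)^-1)%:E)%E).
  by rewrite lee_wpmul2r ?lee_fin ?invr_ge0 ?(ltW l0)// lne_le_EFin// dn.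
rewrite -EFinM -EFinD lee_fin mulrBl mulfK ?gt_eqF// addrC lerD2l.
rewrite ler_pdivrMr// (le_trans (ler_norm b))//.
rewrite mulrC -ler_pdivrMr// ltW// (lt_trans _ lnn)// ltrDl//.
Qed.

Section order.
Context {R : realType} {m : nat} (nu : {finite_measure set 'rV[R]_m -> \bar R}).
Context (k : nat) (p q : R) (p1 : 1 < p) (pq : p <= q).
Let rho := q * (k.+1%:R - m%:R / p).
Context (rho0 : 0 < rho).
Context (nu_cube : nu (~` half_open_unit_cube R m) = 0%E).
Context (nu_neq0 : nu (half_open_unit_cube R m) != 0%E).
Context (q1 : (1 <= q%:E)%E).
Let d n := kolmogorov_diameter (Lq_norm nu q1) (sobolev_sphere_in_Lq nu q1 k.+1 p) n.
Let ord := upper_approximation_order (Lq_norm nu q1) (sobolev_sphere_in_Lq nu q1 k.+1 p).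

Let q0 : 0 < q. Proof. by rewrite (lt_le_trans _ pq)// (lt_trans _ p1). Qed.
Let nuQ := fine (nu (half_open_unit_cube R m)).
Let nuQ0 : 0 < nuQ.
Proof.
rewrite fine_gt0// lt0e nu_neq0 measure_ge0/= ltey_eq fin_num_measure//.
exact: measurable_half_open_unit_cube.
Qed.

Lemma diameter_bound : exists2 C : R, 0 <= C & forall t N n, 0 < t -> t <= nuQ ->
  (forall n (l : 'I_m -> nat), (N <= n)%N -> weight nu rho n l < t) ->
  (#|@selected R m nu rho t N| * k.+1 ^ m <= n)%N -> (d n <= (C * t `^ q^-1)%:E)%E.
Proof.
have delta0 : 0 < k.+1%:R - m%:R / p by move: rho0; rewrite /rho pmulr_rgt0.
have [C C0 HC] := local_approximation p1 delta0.
exists C => // t N n t0 tnu HN; exact: diameter_le.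
Qed.

(** A fixed partition bounds all the diameters of large index by one constant. *)
Lemma order_le0 : (ord <= 0)%E.
Proof.
have [C C0 HC] := diameter_bound.
have [N HN] := weight_small nu rho0 nuQ0.
have Hd n : (#|@selected R m nu rho nuQ N| * k.+1 ^ m <= n)%N ->
    (d n <= (expR (ln (C * nuQ `^ q^-1 + 1) - 0 * ln n%:R))%:E)%E.
  move=> nn; apply: (le_trans (HC _ _ _ nuQ0 (lexx _) (fun n l => @HN n l) nn)).
  have c0 : 0 <= C * nuQ `^ q^-1 by rewrite mulr_ge0 ?powR_ge0.
  by rewrite lee_fin mul0r subr0 lnK ?posrE ?ltr_wpDl// lerDl.
by have := limn_esup_lne_ln Hd; rewrite oppr0.
Qed.

(** The threshold t is chosen so that t^s' = K1 / n, which makes the number of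
    functions used at most n. *)
Lemma order_le s s' : 0 < s -> s < s' -> (Lq_spectrum nu s - (rho * s)%:E <= 0)%E ->
  (ord <= (- (q * s')^-1)%:E)%E.
Proof.
move=> s0 ss' Hs; have s'0 : 0 < s' by rewrite (lt_trans s0).
have [C C0 HC] := diameter_bound.
have [K K0 HK] := card_selected_le rho0 nu_cube s0 ss' Hs.
pose K1 := K * (k.+1 ^ m)%:R + 1.
have K10 : 0 < K1 by rewrite ltr_wpDl ?mulr_ge0.
pose tm := Num.min 1 nuQ.
have tm0 : 0 < tm by rewrite lt_min ltr01 nuQ0.
(* From n0 on, the threshold is at most tm, hence at most 1 and at most nu(cube). *)
pose n0 := (Num.truncn (K1 / tm `^ s')).+1.
apply: (@limn_esup_lne_ln _ _ _ (ln (C + 1) + ln K1 * (q * s')^-1) n0) => n nn.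
have n_gt0 : 0 < n%:R :> R by rewrite ltr0n (leq_trans _ nn).
pose t := (K1 / n%:R) `^ s'^-1.
have kn0 : 0 < K1 / n%:R by rewrite divr_gt0.
have t0 : 0 < t by exact: powR_gt0.
have ts' : t `^ s' = K1 / n%:R by rewrite /t -powRrM mulVf ?gt_eqF// powRr1// ltW.
have ttm : t <= tm.
  have tmE : tm = (tm `^ s') `^ s'^-1.
    by rewrite -powRrM mulfV ?gt_eqF// powRr1// ltW.
  rewrite [leRHS]tmE /t.
  apply: ge0_ler_powR; rewrite ?nnegrE ?invr_ge0 ?(ltW s'0) ?(ltW kn0) ?powR_ge0//.
  rewrite ler_pdivrMr// mulrC -ler_pdivrMr ?powR_gt0//.
  by rewrite (le_trans (ltW (truncnS_gt _)))// ler_nat.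
have [t1 tnu] : t <= 1 /\ t <= nuQ by move: ttm; rewrite le_min => /andP.
have [N HN] := weight_small nu rho0 t0.
have seln : (#|@selected R m nu rho t N| * k.+1 ^ m <= n)%N.
  rewrite -(ler_nat R) natrM; have H := HK t N t0 t1.
  apply: (@le_trans _ _ (K * t `^ (- s') * (k.+1 ^ m)%:R)); first by rewrite ler_wpM2r.
  rewrite powRN ts' invf_div mulrA mulrAC ler_pdivrMr// mulrAC mulrC ler_wpM2l ?ltW//.
  by rewrite ltrDl.
apply: (le_trans (HC _ _ _ t0 tnu (fun n l => @HN n l) seln)); rewrite lee_fin.
have C1 : 0 < C + 1 by rewrite ltr_wpDl.
have -> : ln (C + 1) + ln K1 * (q * s')^-1 - (q * s')^-1 * ln n%:R =
   ln (C + 1) + (q * s')^-1 * ln (K1 / n%:R).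
  by rewrite ln_div ?posrE//; ring.
rewrite expRD lnK ?posrE// -/(powR _ _).
have -> : expR ((q * s')^-1 * ln (K1 / n%:R)) = t `^ q^-1.
  by rewrite /t -powRrM [s'^-1 * _]mulrC -invfM /powR gt_eqF.
by rewrite ler_wpM2r ?powR_ge0// lerDl.
Qed.

(** The bound -1/(q s') holds for all s' above the exponent and is continuous in s';
    the cases where the exponent is infinite or zero correspond to the bounds 0
    and -oo. *)
Lemma order_le_exponent : (ord <= - (1 / (q%:E * spectral_exponent nu rho)))%E.
Proof.
set s0 := spectral_exponent nu rho.
have H s' : (s0 < s'%:E)%E -> (ord <= (- (q * s')^-1)%:E)%E.
  move=> /ereal_inf_lt[_ [s [sgt0 Hs] <-]]; rewrite lte_fin => ss'.
  exact: order_le sgt0 ss' Hs.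
have s0ge0 : (0 <= s0)%E.
  by apply: le_ereal_inf_tmp => _ [s [sgt0 _] <-]; rewrite lee_fin ltW.
clearbody s0; case: s0 H s0ge0 => [s0|_ _|//]; last first.
  rewrite gt0_muley ?lte_fin// invey mule0 oppe0; exact: order_le0.
rewrite lee_fin => H; rewrite le_eqVlt => /predU1P[s00|s00].
  rewrite -s00 mule0 inve0 mul1e /=.
  suff HA : forall A : R, (ord <= A%:E)%E.
    case: (ord) HA => [r /(_ (r - 1))|/(_ 0)|//]; last by rewrite leye_eq.
    by rewrite lee_fin lerBrDr -lerBrDl subrr ler10.
  move=> A.
  pose s' := (q * (`|A| + 1))^-1.
  have A1 : 0 < `|A| + 1 by rewrite ltr_wpDl.
  have s'0 : 0 < s' by rewrite invr_gt0 mulr_gt0.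
  have := H s'; rewrite -s00 lte_fin => /(_ s'0) /le_trans; apply.
  rewrite lee_fin /s' invfM invrK mulrA mulVf ?gt_eqF// mul1r.
  by rewrite lerNl (le_trans (ler_norm _))// normrN lerDl.
have qs0 : 0 < q * s0 by rewrite mulr_gt0.
rewrite -EFinM inver gt_eqF// mul1e -EFinN.
apply/lee_addgt0Pr => e e0.
pose c := (q * s0)^-1; have c0 : 0 < c by rewrite invr_gt0.
(* s' is defined by 1/(q s') = c - e'; halving c keeps this positive. *)
pose e' := Num.min e (c / 2).
have e'0 : 0 < e' by rewrite lt_min e0 divr_gt0.
have ce' : 0 < c - e'.
  by rewrite subr_gt0 gt_min; apply/orP; right; rewrite ltr_pdivrMr// mulr_natr mulr2n ltrDl.
pose s' := (q * (c - e'))^-1.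
have ss' : s0 < s'.
  have cs : q * s0 = c^-1 by rewrite invrK.
  rewrite /s' invfM mulrC ltr_pdivlMr// mulrC cs ltf_pV2 ?posrE//.
  by rewrite ltrBlDr ltrDl.
have := H s'; rewrite lte_fin => /(_ ss') /le_trans; apply.
rewrite -EFinD lee_fin /s' invfM invrK mulrA mulVf ?gt_eqF// mul1r -/c.
by rewrite opprB addrC lerD2l ge_min lexx.
Qed.

End order.

Theorem theorem1p1 (R : realType) (m l : nat) (p q : R)
    (nu : {finite_measure set 'rV[R]_m -> \bar R})
    (m_gt0 : (0 < m)%N) (l_gt0 : (0 < l)%N)
    (p_gt1 : 1 < p) (p_le_q : p <= q)
    (rho_gt0 : 0 < q * (l%:R - m%:R / p))
    (nu_cube : nu (~` half_open_unit_cube R m) = 0%E)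
    (nu_neq0 : nu (half_open_unit_cube R m) != 0%E) :
  (upper_approximation_order
     (Lq_norm nu (exponent_ge1 p_gt1 p_le_q))
     (sobolev_sphere_in_Lq nu (exponent_ge1 p_gt1 p_le_q) l p)
   <= - (1 / (q%:E * spectral_exponent nu (q * (l%:R - m%:R / p)))))%E.
Proof.
case: l l_gt0 rho_gt0 => [//|k] _ rho_gt0.
exact: (order_le_exponent p_gt1 p_le_q rho_gt0 nu_cube nu_neq0).
Qed.
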